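(* Let $(\mathcal{D},g)$ be a contact sub-Riemannian or sub-Lorentzian structure on a three-dimensional manifold $M$. Assume that $h=0$ and that $\kappa$ is constant and non-zero. Let $G^\kappa$ be the extended metric $G^c$ with $c=\kappa$ and let $\nabla^\kappa$ be its Levi-Civita connection. Then the pair $([G^\kappa],\nabla^\kappa)$ defines an Einstein-Weyl structure on $M$. This Einstein-Weyl structure has Riemannian signature if $g$ is sub-Riemannian and $\kappa>0$, and otherwise it has Lorentzian signature.
   Context: All objects are smooth. A contact sub-Riemannian (resp. sub-Lorentzian) structure on a 3-manifold $M$ is a pair $(\mathcal{D},g)$ with $\mathcal{D}\subset TM$ a contact distribution (rank 2) and $g$ a metric on $\mathcal{D}$ that is positive-definite (resp. of signature $(-,+)$). Choose (locally) an orientation of $\mathcal{D}$ and a positively oriented orthonormal frame $(X_1,X_2)$ of $\mathcal{D}$: $g(X_1,X_2)=0$, $g(X_2,X_2)=1$, and $g(X_1,X_1)=1$ in the sub-Riemannian case, $g(X_1,X_1)=-1$ in the sub-Lorentzian case. The Reeb vector field $X_0$ is the vector field such that $[X_0,X_i]$ is a section of $\mathcal{D}$ for $i=1,2$ and $[X_1,X_2]=X_0 \bmod \mathcal{D}$; it does not depend on the choice of frame, and reversing the orientation replaces $X_0$ by $-X_0$. The structural functions $c_{ij}^k$ are defined by $[X_0,X_1]=c_{01}^1X_1+c_{01}^2X_2$, $[X_0,X_2]=c_{02}^1X_1+c_{02}^2X_2$, $[X_1,X_2]=c_{12}^1X_1+c_{12}^2X_2+X_0$. The invariant $h=\frac12\mathcal{L}_{X_0}g$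 is the symmetric bilinear form on $\mathcal{D}$ given by $h(X,Y)=\frac12\left(X_0(g(X,Y))-g([X_0,X],Y)-g(X,[X_0,Y])\right)$; the condition $h=0$ does not depend on the orientation. The invariant $\kappa$ is the function $\kappa = X_1(c_{12}^2)-X_2(c_{12}^1)-(c_{12}^1)^2-(c_{12}^2)^2+\frac{1}{2}(c_{01}^2-c_{02}^1)$ in the sub-Riemannian case, and $\kappa = X_1(c_{12}^2)+X_2(c_{12}^1)+(c_{12}^1)^2-(c_{12}^2)^2+\frac{1}{2}(c_{01}^2+c_{02}^1)$ in the sub-Lorentzian case. For a constant $c\in\mathbb{R}\setminus\{0\}$, $G^c$ denotes the metric on $M$ which restricts to $g$ on $\mathcal{D}$ and satisfies $G^c(X_0,X_0)=c$, $G^c(X_0,X_i)=0$ for $i=1,2$. It does not depend on the orientation. A Weyl structure on a 3-manifold is a pair $([G],\nabla)$ of a conformal class of (pseudo-)Riemannian metrics and a torsion-free linear connection $\nabla$ with $\nabla G=\eta\otimes G$ for some one-form $\eta$ (depending on the representative $G$). It is Einstein-Weyl if $Ric(\nabla)_{sym}=\frac13 R_G\,G$, where $Ric(\nabla)_{sym}$ is the symmetric part of the Ricci tensor of $\nabla$ and $R_G$ is the scalar curvature of $\nabla$ with respect to $G$ (the $G$-trace of the Ricci tensor). In dimension 3, Riemannian signature means positive-definite and Lorentzian signature means indefinite non-degenerate, i.e. $(-,+,+)$ up to an overall sign. *)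

(* Defs.v *)
From HB Require Import structures.
From mathcomp Require Import all_boot all_order all_algebra.
From mathcomp Require Import all_classical all_reals all_analysis.
Set Implicit Arguments.
Unset Strict Implicit.
Unset Printing Implicit Defensive.
Import Order.TTheory GRing.Theory Num.Theory.
Import numFieldNormedType.Exports.
Local Open Scope classical_set_scope.
Local Open Scope ring_scope.

Fixpoint Ck (R : realType) (W : normedModType R) (k : nat)
    (A : set 'rV[R]_3) (f : 'rV[R]_3 -> W) : Prop :=
  match k with
  | 0 => forall x, A x -> {for x, continuous f}
  | j.+1 => (forall x, A x -> differentiable f x) /\
            (forall v : 'rV[R]_3, Ck j A ('D_v f))
  end.

Definition smooth (R : realType) (W : normedModType R)
    (A : set 'rV[R]_3) (f : 'rV[R]_3 -> W) : Prop :=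
  forall k, Ck k A f.

Record chart (R : realType) (M : topologicalType) := Chart {
  chart_map :> M -> 'rV[R]_3;
  chart_inv : 'rV[R]_3 -> M;
  chart_src : set M;
  chart_tgt : set 'rV[R]_3;
  chart_src_open : open chart_src;
  chart_tgt_open : open chart_tgt;
  chart_map_tgt : forall p, chart_src p -> chart_tgt (chart_map p);
  chart_inv_src : forall x, chart_tgt x -> chart_src (chart_inv x);
  chart_mapK : forall p, chart_src p -> chart_inv (chart_map p) = p;
  chart_invK : forall x, chart_tgt x -> chart_map (chart_inv x) = x;
  chart_map_cont : forall p, chart_src p -> {for p, continuous chart_map};
  chart_inv_cont : forall x, chart_tgt x -> {for x, continuous chart_inv}
}.

Definition chart_image (R : realType) (M : topologicalType) (phi : chart R M)
    (U : set M) : set 'rV[R]_3 :=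
  [set x | chart_tgt phi x /\ U (chart_inv phi x)].

(* [chart_at] selects one chart of the atlas around each point. It is used only
   to represent tangent vectors by triples of coordinates. *)
Record manifold3 (R : realType) := Manifold3 {
  points :> topologicalType;
  points_hausdorff : hausdorff_space points;
  points_second_countable : @second_countable points;
  atlas : set (chart R points);
  atlas_compatible : forall phi psi, atlas phi -> atlas psi ->
    smooth (chart_image phi (chart_src psi)) (psi \o chart_inv phi);
  chart_at : points -> chart R points;
  chart_at_atlas : forall p, atlas (chart_at p);
  chart_at_src : forall p, chart_src (chart_at p) p
}.

Definition smooth_fun (R : realType) (M : manifold3 R) (W : normedModType R)
    (U : set M) (f : M -> W) : Prop :=
  forall phi, @atlas R M phi ->
    smooth (chart_image phi U) (f \o chart_inv phi).

(* A tangent vector at [p] is given by its components in the chart [chart_at p].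
   A tensor field on an open set [U] is a total function of the point whose
  values outside [U] are irrelevant. *)

Notation vfield M := (points M -> 'rV_3).

Definition tderiv (R : realType) (M : manifold3 R) (W : normedModType R)
    (f : M -> W) (p : M) (v : 'rV[R]_3) : W :=
  'D_v (f \o chart_inv (chart_at p)) (chart_at p p).

Definition vderiv (R : realType) (M : manifold3 R) (W : normedModType R)
    (X : M -> 'rV[R]_3) (f : M -> W) : M -> W :=
  fun p => tderiv f p (X p).

(* [vderiv X phi] is the triple of components of [X] in the chart [phi]. *)
Definition smooth_vfield (R : realType) (M : manifold3 R)
    (U : set M) (X : M -> 'rV[R]_3) : Prop :=
  forall phi : chart R M, atlas phi ->
    smooth_fun (U `&` chart_src phi) (vderiv X phi).

Definition bracket (R : realType) (M : manifold3 R)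
    (X Y : M -> 'rV[R]_3) : M -> 'rV[R]_3 :=
  fun p => vderiv X (vderiv Y (chart_at p)) p - vderiv Y (vderiv X (chart_at p)) p.

(* A one-form is a field of covectors, written as columns. *)
Definition form_eval (R : realType) (M : manifold3 R)
    (a : M -> 'cV[R]_3) (X : M -> 'rV[R]_3) : M -> R :=
  fun p => (X p *m a p) 0 0.

Definition smooth_form (R : realType) (M : manifold3 R)
    (U : set M) (a : M -> 'cV[R]_3) : Prop :=
  forall V X, open V -> V `<=` U -> smooth_vfield V X ->
    smooth_fun V (form_eval a X : M -> R^o).

Definition dform (R : realType) (M : manifold3 R) (a : M -> 'cV[R]_3)
    (X Y : M -> 'rV[R]_3) : M -> R :=
  fun p => vderiv X (form_eval a Y : M -> R^o) p
         - vderiv Y (form_eval a X : M -> R^o) p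
         - form_eval a (bracket X Y) p.

Definition wedge_dform (R : realType) (M : manifold3 R) (a : M -> 'cV[R]_3)
    (X Y Z : M -> 'rV[R]_3) : M -> R :=
  fun p => form_eval a X p * dform a Y Z p + form_eval a Y p * dform a Z X p
         + form_eval a Z p * dform a X Y p.

Definition frame_mx (R : realType) (M : manifold3 R)
    (X : 'I_3 -> M -> 'rV[R]_3) (p : M) : 'M[R]_3 :=
  \matrix_(i, j) X i p 0 j.

Definition section_on (R : realType) (M : manifold3 R)
    (D : M -> {vspace 'rV[R]_3}) (U : set M) (X : M -> 'rV[R]_3) : Prop :=
  smooth_vfield U X /\ forall p, U p -> X p \in D p.

Definition distribution2 (R : realType) (M : manifold3 R)
    (D : M -> {vspace 'rV[R]_3}) : Prop :=
  (forall p, \dim (D p) = 2%N) /\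
  forall p, exists U X Y, [/\ open U, U p, smooth_vfield U X, smooth_vfield U Y
    & forall q, U q -> D q = <<[:: X q; Y q]>>%VS].

Definition contact (R : realType) (M : manifold3 R)
    (D : M -> {vspace 'rV[R]_3}) : Prop :=
  forall p, exists U a, [/\ open U, U p, smooth_form U a,
    (forall q v, U q -> (v \in D q) = ((v *m a q) 0 0 == 0))
    & forall V (X : 'I_3 -> M -> 'rV[R]_3), open V -> V `<=` U ->
        (forall i, smooth_vfield V (X i)) ->
        forall q, V q -> frame_mx X q \in unitmx ->
          wedge_dform a (X 0) (X 1) (X 2) q != 0].

Inductive sub_kind := SubRiemannian | SubLorentzian.

(* Only the values of [cs_g p] on vectors of [cs_D p] are meaningful. *)
Record contact_structure (R : realType) (M : manifold3 R) := ContactStructure {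
  cs_kind : sub_kind;
  cs_D : M -> {vspace 'rV[R]_3};
  cs_g : M -> 'rV[R]_3 -> 'rV[R]_3 -> R;
  cs_distribution : distribution2 cs_D;
  cs_contact : contact cs_D;
  cs_sym : forall p u v, u \in cs_D p -> v \in cs_D p ->
    cs_g p u v = cs_g p v u;
  cs_linear : forall p (a : R) u u' v,
    u \in cs_D p -> u' \in cs_D p -> v \in cs_D p ->
    cs_g p (a *: u + u') v = a * cs_g p u v + cs_g p u' v;
  cs_smooth : forall U X Y, open U ->
    section_on cs_D U X -> section_on cs_D U Y ->
    smooth_fun U ((fun p => cs_g p (X p) (Y p)) : M -> R^o);
  cs_signature : forall p,
    match cs_kind with
    | SubRiemannian => forall v, v \in cs_D p -> v != 0 -> 0 < cs_g p v v
    | SubLorentzian => exists u v, [/\ u \in cs_D p, v \in cs_D p,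
        cs_g p u u = -1, cs_g p v v = 1 & cs_g p u v = 0]
    end
}.

(* [X 1], [X 2] is an orthonormal frame of [cs_D S] over [U], positively
   oriented for the orientation which it defines, and [X 0] is the Reeb field
   of that orientation. *)
Definition adapted_frame (R : realType) (M : manifold3 R)
    (S : contact_structure M) (U : set M) (X : 'I_3 -> M -> 'rV[R]_3) : Prop :=
  [/\ open U,
      section_on (cs_D S) U (X 1) /\ section_on (cs_D S) U (X 2),
      smooth_vfield U (X 0),
      (forall p, U p ->
        [/\ cs_g S p (X 1 p) (X 2 p) = 0, cs_g S p (X 2 p) (X 2 p) = 1
          & cs_g S p (X 1 p) (X 1 p) =
              match cs_kind S with SubRiemannian => 1 | SubLorentzian => -1 end])
    & (forall p, U p ->
        [/\ bracket (X 0) (X 1) p \in cs_D S p,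
            bracket (X 0) (X 2) p \in cs_D S p
          & bracket (X 1) (X 2) p - X 0 p \in cs_D S p])].

(* [structural_fun X i j k] is the component of [[X i, X j]] along [X k]. *)
Definition structural_fun (R : realType) (M : manifold3 R)
    (X : 'I_3 -> M -> 'rV[R]_3) (i j k : 'I_3) : M -> R :=
  fun p => (bracket (X i) (X j) p *m invmx (frame_mx X p)) 0 k.

Definition invariant_h (R : realType) (M : manifold3 R)
    (S : contact_structure M) (X0 X Y : M -> 'rV[R]_3) : M -> R :=
  fun p => 2^-1 *
    (vderiv X0 ((fun q => cs_g S q (X q) (Y q)) : M -> R^o) p
     - cs_g S p (bracket X0 X p) (Y p) - cs_g S p (X p) (bracket X0 Y p)).

Definition h_vanishes (R : realType) (M : manifold3 R)
    (S : contact_structure M) : Prop :=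
  forall U X Y Z, adapted_frame S U X ->
    section_on (cs_D S) U Y -> section_on (cs_D S) U Z ->
    forall p, U p -> invariant_h S (X 0) Y Z p = 0.

Definition kappa_formula (R : realType) (M : manifold3 R)
    (s : sub_kind) (X : 'I_3 -> M -> 'rV[R]_3) : M -> R :=
  let c : 'I_3 -> 'I_3 -> 'I_3 -> M -> R^o := structural_fun X in
  match s with
  | SubRiemannian => fun p =>
      vderiv (X 1) (c 1 2 2) p - vderiv (X 2) (c 1 2 1) p
      - c 1 2 1 p ^+ 2 - c 1 2 2 p ^+ 2 + 2^-1 * (c 0 1 2 p - c 0 2 1 p)
  | SubLorentzian => fun p =>
      vderiv (X 1) (c 1 2 2) p + vderiv (X 2) (c 1 2 1) p
      + c 1 2 1 p ^+ 2 - c 1 2 2 p ^+ 2 + 2^-1 * (c 0 1 2 p + c 0 2 1 p)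
  end.

Definition is_invariant_kappa (R : realType) (M : manifold3 R)
    (S : contact_structure M) (K : M -> R) : Prop :=
  forall U X, adapted_frame S U X ->
    forall p, U p -> K p = kappa_formula (cs_kind S) X p.

(* A field of bilinear forms is given by its Gram matrix at [p] in the
   coordinate basis of [chart_at p]. *)
Definition mform (R : realType) (A : 'M[R]_3) (u v : 'rV[R]_3) : R :=
  (u *m A *m v^T) 0 0.

Definition is_metric (R : realType) (M : manifold3 R) (G : M -> 'M[R]_3) : Prop :=
  (forall p, (G p)^T = G p /\ G p \in unitmx) /\
  forall U X Y, open U -> smooth_vfield U X -> smooth_vfield U Y ->
    smooth_fun U ((fun p => mform (G p) (X p) (Y p)) : M -> R^o).

Definition is_extended_metric (R : realType) (M : manifold3 R)
    (S : contact_structure M) (c : R) (G : M -> 'M[R]_3) : Prop :=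
  [/\ is_metric G,
      (forall p u v, u \in cs_D S p -> v \in cs_D S p ->
        mform (G p) u v = cs_g S p u v)
    & forall U X, adapted_frame S U X -> forall p, U p ->
        [/\ mform (G p) (X 0 p) (X 0 p) = c,
            mform (G p) (X 0 p) (X 1 p) = 0
          & mform (G p) (X 0 p) (X 2 p) = 0]].

Definition conformal_class (R : realType) (M : manifold3 R)
    (G : M -> 'M[R]_3) : set (M -> 'M[R]_3) :=
  [set G' | exists f : M -> R, [/\ smooth_fun setT (f : M -> R^o),
     (forall p, 0 < f p) & forall p, G' p = f p *: G p]].

(* A linear connection acts on the vector fields over every open set [U];
   the locality of the action, hence its compatibility with restriction, follows
   from the axioms, applied over [V] to the indicator function of [V]. *)
Definition is_connection (R : realType) (M : manifold3 R)
    (nabla : vfield M -> vfield M -> M -> 'rV[R]_3) : Prop :=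
  forall U (f : M -> R) X X' Y Y', open U -> smooth_fun U (f : M -> R^o) ->
    smooth_vfield U X -> smooth_vfield U X' ->
    smooth_vfield U Y -> smooth_vfield U Y' ->
    smooth_vfield U (nabla X Y) /\
    forall p, U p ->
      [/\ nabla (fun q => f q *: X q + X' q) Y p = f p *: nabla X Y p + nabla X' Y p,
          nabla X (fun q => Y q + Y' q) p = nabla X Y p + nabla X Y' p
        & nabla X (fun q => f q *: Y q) p =
            f p *: nabla X Y p + vderiv X (f : M -> R^o) p *: Y p].

Definition torsion_free (R : realType) (M : manifold3 R)
    (nabla : vfield M -> vfield M -> M -> 'rV[R]_3) : Prop :=
  forall U X Y, open U -> smooth_vfield U X -> smooth_vfield U Y ->
    forall p, U p -> nabla X Y p - nabla Y X p = bracket X Y p.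

(* (nabla_X G)(Y, Z) *)
Definition cov_metric (R : realType) (M : manifold3 R)
    (nabla : vfield M -> vfield M -> M -> 'rV[R]_3) (G : M -> 'M[R]_3)
    (X Y Z : M -> 'rV[R]_3) : M -> R :=
  fun p => vderiv X ((fun q => mform (G q) (Y q) (Z q)) : M -> R^o) p
         - mform (G p) (nabla X Y p) (Z p) - mform (G p) (Y p) (nabla X Z p).

Definition levi_civita (R : realType) (M : manifold3 R) (G : M -> 'M[R]_3)
    (nabla : vfield M -> vfield M -> M -> 'rV[R]_3) : Prop :=
  [/\ is_connection nabla, torsion_free nabla
    & forall U X Y Z, open U ->
        smooth_vfield U X -> smooth_vfield U Y -> smooth_vfield U Z ->
        forall p, U p -> cov_metric nabla G X Y Z p = 0].

Definition curvature (R : realType) (M : manifold3 R)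
    (nabla : vfield M -> vfield M -> M -> 'rV[R]_3)
    (X Y Z : M -> 'rV[R]_3) : M -> 'rV[R]_3 :=
  fun p => nabla X (nabla Y Z) p - nabla Y (nabla X Z) p
         - nabla (bracket X Y) Z p.

(* The [i]-th coordinate vector field of [chart_at p], defined on the source of
   this chart, with its value at [q] converted to the chart [chart_at q]. *)
Definition coord_vfield (R : realType) (M : manifold3 R) (p : M) (i : 'I_3) :
    M -> 'rV[R]_3 :=
  fun q => 'D_(delta_mx 0 i) (chart_at q \o chart_inv (chart_at p)) (chart_at p q).

(* Ric(Y, Z) is the trace of X |-> R(X, Y) Z; the entries are taken in the
   coordinate basis of [chart_at p]. *)
Definition ricci (R : realType) (M : manifold3 R)
    (nabla : vfield M -> vfield M -> M -> 'rV[R]_3) (p : M) : 'M[R]_3 :=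
  \matrix_(i, j) \sum_(k < 3)
    curvature nabla (coord_vfield p k) (coord_vfield p i) (coord_vfield p j) p 0 k.

Definition ricci_sym (R : realType) (M : manifold3 R)
    (nabla : vfield M -> vfield M -> M -> 'rV[R]_3) (p : M) : 'M[R]_3 :=
  2^-1 *: (ricci nabla p + (ricci nabla p)^T).

Definition scalar_curvature (R : realType) (M : manifold3 R)
    (nabla : vfield M -> vfield M -> M -> 'rV[R]_3) (G : M -> 'M[R]_3) (p : M) : R :=
  \tr (invmx (G p) *m ricci nabla p).

Definition weyl_structure (R : realType) (M : manifold3 R)
    (C : set (M -> 'M[R]_3))
    (nabla : vfield M -> vfield M -> M -> 'rV[R]_3) : Prop :=
  [/\ (exists2 G, is_metric G & C = conformal_class G),
      is_connection nabla, torsion_free nabla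
    & forall G, C G -> exists2 eta, smooth_form setT eta &
        forall U X Y Z, open U ->
          smooth_vfield U X -> smooth_vfield U Y -> smooth_vfield U Z ->
          forall p, U p ->
            cov_metric nabla G X Y Z p = form_eval eta X p * mform (G p) (Y p) (Z p)].

Definition einstein_weyl (R : realType) (M : manifold3 R)
    (C : set (M -> 'M[R]_3))
    (nabla : vfield M -> vfield M -> M -> 'rV[R]_3) : Prop :=
  weyl_structure C nabla /\
  forall G, C G -> forall p,
    ricci_sym nabla p = (3^-1 * scalar_curvature nabla G p) *: G p.

Definition riemannian_signature (R : realType) (M : manifold3 R)
    (C : set (M -> 'M[R]_3)) : Prop :=
  forall G, C G -> forall p v, v != 0 -> 0 < mform (G p) v v.

Definition lorentzian_signature (R : realType) (M : manifold3 R)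
    (C : set (M -> 'M[R]_3)) : Prop :=
  forall G, C G -> forall p, G p \in unitmx /\
    exists u v, mform (G p) u u < 0 /\ 0 < mform (G p) v v.

(* Main.v *)
(** Around each point Gram-Schmidt and the contact form provide an adapted frame
    [X0, X1, X2], which is [G]-orthogonal with constant norms [kappa], [eps], [1]
    where [eps = 1] (sub-Riemannian) or [eps = -1] (sub-Lorentzian).  The
    condition [h = 0] leaves only three free structural functions, and the Koszul
    formula gives the Levi-Civita connection in the frame.  The formula for
    [kappa] and the Jacobi identity then yield
    [R(X, Y) Z = (eps * kappa / 4) (G(Y, Z) X - G(X, Z) Y)]
    on the frame, hence for all fields since curvature is tensorial.  So [G] has
    constant curvature, [Ric = (eps * kappa / 2) G], and the Einstein-Weyl
    equation holds for every metric [f G] of the conformal class, with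
    [eta = d f / f].  That a bracket acts on functions as a commutator rests on
    the symmetry of second derivatives, obtained from the mean value theorem.  *)

Require Import Defs.
From HB Require Import structures.
From mathcomp Require Import all_boot all_order all_algebra.
From mathcomp Require Import all_classical all_reals all_analysis.
From mathcomp Require Import ring lra.
Set Implicit Arguments.
Unset Strict Implicit.
Unset Printing Implicit Defensive.
Import Order.TTheory GRing.Theory Num.Theory.
Import numFieldNormedType.Exports.
Local Open Scope classical_set_scope.
Local Open Scope ring_scope.

(** For constant curvature the choice of [kappa] as norm of the Reeb field is forced. With an
    arbitrary norm [c] and [h = 0], the planes spanned by X0 and one of X1, X2 have curvature
    [eps * c / 4], while the plane of X1 and X2 has curvature [eps * (kappa - 3 * c / 4)]; these
    agree exactly when [c = kappa]. Constancy of [kappa] makes all norms of the frame constant, so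
    that no derivative of the metric enters the Koszul formula. The relation [eps * eps = 1] merges
    the two signatures into one computation. The obstacle is the encoding of vectors: the triple
    [X p] refers to [chart_at p], an arbitrary choice that need not vary continuously with [p]. A
    field is therefore not differentiated as a function; it is studied through its action on
    functions and on chart maps. Fields are moreover total functions that matter only on an open
    set, so each operator needs a locality lemma before an identity on that set can be substituted
    inside it. *)

(** * Directional derivatives in normed spaces *)

Section ScaleDifferential.
Variables (R : realType) (V W : normedModType R).
Implicit Types (f : V -> R^o) (F : V -> W).

(** With scaling registered as a bilinear map, the product rule is an instance of the differential
    of a bilinear map. *)
Let scaler_bilinear : bilinear_for
  (GRing.Scale.Law.clone _ _ *:%R _) (GRing.Scale.Law.clone _ _ *:%R _)
  (@GRing.scale R W : R^o -> W -> W).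
Proof.
split=> [u'|u] a x y /=; first by rewrite scalerDl scalerA.
by rewrite scalerDr !scalerA mulrC.
Qed.

HB.instance Definition _ := bilinear_isBilinear.Build R R^o W W _ _
  (@GRing.scale R W : R^o -> W -> W) scaler_bilinear.

Let scale2 : {bilinear R^o -> W -> W} := (@GRing.scale R W : R^o -> W -> W).

Lemma differentiable_scaler f F x : differentiable f x -> differentiable F x ->
  differentiable (fun y => f y *: F y) x.
Proof.
move=> df dF.
have -> : (fun y => f y *: F y) =
    (fun p : R^o * W => scale2 p.1 p.2) \o (fun y => (f y, F y)) by [].
apply: differentiable_comp; first exact: differentiable_pair.
by apply: differentiable_bilin => p; exact: scale_continuous.
Qed.

Lemma derive_scaler f F x v : differentiable f x -> differentiable F x ->
  'D_v (fun y => f y *: F y) x = f x *: 'D_v F x + 'D_v f x *: F x.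
Proof.
move=> df dF; rewrite !deriveE//; last exact: differentiable_scaler.
have -> : (fun y => f y *: F y) =
    (fun p : R^o * W => scale2 p.1 p.2) \o (fun y => (f y, F y)) by [].
have cs : continuous (fun p : R^o * W => scale2 p.1 p.2).
  by move=> p; exact: scale_continuous.
rewrite diff_comp ?diff_bilin ?diff_pair//; first exact: differentiable_pair.
exact: differentiable_bilin.
Qed.

End ScaleDifferential.

Lemma derive_comp (R : realType) (U V W : normedModType R) (f : U -> V)
    (g : V -> W) x v : differentiable f x -> differentiable g (f x) ->
  'D_v (g \o f) x = 'D_('D_v f x) g (f x).
Proof.
move=> df dg; rewrite deriveE; last exact: differentiable_comp.
by rewrite diff_comp// (deriveE _ dg) (deriveE _ df).
Qed.

Lemma derive_linear (R : realType) (V W : normedModType R) (f : V -> W) x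
    (I : Type) (r : seq I) (a : I -> R) (u : I -> V) : differentiable f x ->
  'D_(\sum_(i <- r) a i *: u i) f x = \sum_(i <- r) a i *: 'D_(u i) f x.
Proof.
move=> df; transitivity ('d f x (\sum_(i <- r) a i *: u i)).
  exact: deriveE.
rewrite linear_sum; apply: eq_bigr => i _.
by rewrite linearZ deriveE.
Qed.

Lemma deriveDl (R : realType) (V W : normedModType R) (f : V -> W) x
    (a : R) (u v : V) : differentiable f x ->
  'D_(a *: u + v) f x = a *: 'D_u f x + 'D_v f x.
Proof. by move=> df; rewrite !(deriveE _ df) linearP. Qed.

Lemma derive_linear_comp (R : realType) (U V W : normedModType R)
    (L : {linear V -> W}) (f : U -> V) x v : continuous L ->
  differentiable f x -> 'D_v (L \o f) x = L ('D_v f x).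
Proof.
move=> cL df; have dL : differentiable L (f x) by exact: linear_differentiable.
rewrite (derive_comp _ df dL) (deriveE _ dL).
by rewrite diff_lin.
Qed.

(** The difference [g - f] vanishes near [x], so the zero map is its differential, and [g] is a sum
    of two differentiable maps. *)
Lemma near_differentiable (R : realType) (V W : normedModType R) (f g : V -> W)
    x : (\near x, f x = g x) -> differentiable f x -> differentiable g x.
Proof.
move=> fg df.
have -> : g = f + (g - f) by rewrite addrC subrK.
apply: differentiableD => //.
set z := g - f.
have z0 : \forall y \near x, z y = 0.
  by near=> y; rewrite /z !fctE (near fg y)// subrr.
have e : z \o shift x = cst (z x) + (0 : V -> W) +o_ 0 id.
  apply/eqaddoP => _/posnumP[k]; rewrite (nbhs_singleton z0).
  have : \forall y \near 0, z (y + x) = 0.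
    move: z0; rewrite (near_shift 0).
    by apply: filter_app; near=> y; rewrite /= subr0.
  apply: filter_app; near=> y => zy.
  by rewrite -[X in `|X|]/(z (y + x) - (0 + 0)) zy addr0 subrr normr0 mulr_ge0.
have c0 : continuous (0 : V -> W) by move=> y; exact: cst_continuous.
have d0 : 'd z x = (0 : V -> W) :> (V -> W).
  exact: (@diff_unique _ _ _ z (\0 : {linear V -> W}) x c0 e).
apply/diff_locallyP; rewrite d0; split; first exact: c0.
exact: e.
Unshelve. all: by end_near. Qed.

Lemma near_continuous_at (T U : topologicalType) (f g : T -> U) (x : T) :
  (\near x, f x = g x) -> {for x, continuous f} -> {for x, continuous g}.
Proof.
move=> fg cf; have cfx : f @ x --> f x by exact: cf.
apply: (@cvg_trans _ (f @ x)); last by rewrite -(nbhs_singleton fg).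
by apply: near_eq_cvg; near=> y; rewrite (near fg y).
Unshelve. all: by end_near. Qed.

(** * Stability of the classes of k times differentiable maps *)

Section CkTheory.
Variable R : realType.
Local Notation E := 'rV[R]_3.
Implicit Types (A B : set E) (k : nat).

Lemma near_open A x (P : E -> Prop) : open A -> A x ->
  (forall y, A y -> P y) -> \forall y \near x, P y.
Proof.
by move=> oA Ax AP; apply: filterS AP _; exact: open_nbhs_nbhs.
Qed.

Lemma eq_in_derive (W : normedModType R) A (f g : E -> W) x v : open A -> A x ->
  (forall y, A y -> f y = g y) -> 'D_v f x = 'D_v g x.
Proof. by move=> oA Ax fg; apply: near_eq_derive; exact: (near_open oA Ax). Qed.

(** Derivatives depend only on germs, so equality on [A] passes to them because [A] is open. *)
Lemma Ck_eq (W : normedModType R) k A (f g : E -> W) : open A ->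
  (forall x, A x -> f x = g x) -> Ck k A f -> Ck k A g.
Proof.
move=> oA; elim: k f g => [|k IH] f g fg /=.
  by move=> cf x Ax; apply: near_continuous_at (cf _ Ax); exact: (near_open oA Ax).
move=> [df Cf]; split=> [x Ax|v].
  by apply: near_differentiable (df _ Ax); exact: (near_open oA Ax).
by apply: IH (Cf v) => x Ax; exact: (eq_in_derive _ oA Ax).
Qed.

Lemma Ck_sub (W : normedModType R) k A B (f : E -> W) : B `<=` A ->
  Ck k A f -> Ck k B f.
Proof.
move=> BA; elim: k f => [|k IH] f /=; first by move=> cf x /BA; exact: cf.
by move=> [df Cf]; split=> [x /BA|v]; [exact: df|exact: IH].
Qed.

Lemma CkS (W : normedModType R) k A (f : E -> W) : Ck k.+1 A f -> Ck k A f.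
Proof.
elim: k f => [|k IH] f [df Cf].
  by move=> x Ax; exact: differentiable_continuous (df _ Ax).
by split=> // v; exact: IH.
Qed.

Lemma Ck_cst (W : normedModType R) k A (c : W) : Ck k A (fun=> c).
Proof.
elim: k c => [|k IH] c /=; first by move=> x _; exact: cst_continuous.
split=> [x _|v]; first exact: differentiable_cst.
by rewrite (_ : 'D_v _ = fun=> 0)//; apply/funext => x; exact: derive_cst.
Qed.

Lemma CkD (W : normedModType R) k A (f g : E -> W) : open A ->
  Ck k A f -> Ck k A g -> Ck k A (fun x => f x + g x).
Proof.
move=> oA; elim: k f g => [|k IH] f g /=.
  by move=> cf cg x Ax; exact: (cvgD (cf _ Ax) (cg _ Ax)).
move=> [df Cf] [dg Cg]; split=> [x Ax|v].
  exact: (differentiableD (df _ Ax) (dg _ Ax)).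
apply: Ck_eq (IH _ _ (Cf v) (Cg v)) => // x Ax; apply/esym.
by apply: deriveD; apply: diff_derivable; [exact: df|exact: dg].
Qed.

Lemma CkZ (W : normedModType R) k A (f : E -> R^o) (g : E -> W) : open A ->
  Ck k A f -> Ck k A g -> Ck k A (fun x => f x *: g x).
Proof.
move=> oA; elim: k f g => [|k IH] f g.
  by move=> cf cg x Ax; exact: (cvgZ (cf _ Ax) (cg _ Ax)).
move=> Cf Cg; have [[df Df] [dg Dg]] := (Cf, Cg).
split=> [x Ax|v]; first exact: (differentiable_scaler (df _ Ax) (dg _ Ax)).
apply: Ck_eq (CkD oA (IH _ _ (CkS Cf) (Dg v)) (IH _ _ (Df v) (CkS Cg))) => // x Ax.
by rewrite derive_scaler//; [exact: df|exact: dg].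
Qed.

Lemma CkN (W : normedModType R) k A (f : E -> W) : open A ->
  Ck k A f -> Ck k A (fun x => - f x).
Proof.
move=> oA Cf; apply: Ck_eq (CkZ oA (Ck_cst k A (-1 : R^o)) Cf) => // x _.
by rewrite scaleN1r.
Qed.

Lemma Ck_sum (W : normedModType R) k A (I : Type) (r : seq I)
    (f : I -> E -> W) : open A ->
  (forall i, Ck k A (f i)) -> Ck k A (fun x => \sum_(i <- r) f i x).
Proof.
move=> oA Cf; elim: r => [|i r IH].
  by apply: Ck_eq (Ck_cst k A 0) => // x _; rewrite big_nil.
by apply: Ck_eq (CkD oA (Cf i) IH) => // x _; rewrite big_cons.
Qed.

Lemma Ck_linear (V W : normedModType R) k A (L : {linear V -> W}) (f : E -> V) :
  open A -> continuous L -> Ck k A f -> Ck k A (L \o f).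
Proof.
move=> oA cL; elim: k f => [|k IH] f /=.
  by move=> cf x Ax; apply: continuous_comp (cf _ Ax) _; exact: cL.
move=> [df Cf]; split=> [x Ax|v].
  apply: differentiable_comp (df _ Ax) _; exact: linear_differentiable.
apply: Ck_eq (IH _ (Cf v)) => // x Ax.
by rewrite derive_linear_comp//; exact: df.
Qed.

Definition coordinate (i : 'I_3) (w : E) : R^o := w 0 i.

Let coordinate_linear i : linear (coordinate i).
Proof. by move=> a u v; rewrite /coordinate !mxE. Qed.

HB.instance Definition _ i :=
  GRing.isLinear.Build R E R^o _ (coordinate i) (coordinate_linear i).

Lemma continuous_coordinate i : continuous (coordinate i).
Proof. exact: coord_continuous. Qed.

Lemma Ck_coord k A (f : E -> E) i : open A -> Ck k A f ->
  Ck k A (fun x => f x 0 i : R^o).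
Proof. by move=> oA; exact: (Ck_linear oA (@continuous_coordinate i)). Qed.

Lemma Ck_comp (W : normedModType R) k A B (f : E -> W) (g : E -> E) :
  open A -> open B -> (forall x, A x -> B (g x)) ->
  Ck k B f -> Ck k A g -> Ck k A (f \o g).
Proof.
move=> oA oB AB; elim: k f => [|k IH] f.
  by move=> cf cg x Ax; apply: continuous_comp (cg _ Ax) (cf _ _); exact: AB.
move=> [df Df] Cg; have [dg Dg] := Cg; split=> [x Ax|v].
  by apply: differentiable_comp (dg _ Ax) (df _ _); exact: AB.
(* [Ck] speaks of derivatives along constant directions, whereas the chain rule produces a direction
   that moves with [x]. Expanding it in the standard basis restores constant directions. *)
have dgE x : A x ->
    'D_v (f \o g) x = \sum_(i < 3) 'D_v g x 0 i *: ('D_(delta_mx 0 i) f \o g) x.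
  move=> Ax; rewrite (derive_comp _ (dg _ Ax)); last exact/df/AB.
  by rewrite {1}[X in 'D_X f _]row_sum_delta derive_linear//; exact/df/AB.
have := @Ck_sum W k A _ (index_enum 'I_3)
  (fun i x => 'D_v g x 0 i *: ('D_(delta_mx 0 i) f \o g) x) oA.
move=> H; apply: Ck_eq (H _) => // [x Ax|i]; first by rewrite dgE.
apply: CkZ => //; last exact: IH (Df _) (CkS Cg).
exact: (Ck_coord _ oA (Dg v)).
Qed.

(** The derivative is that of [f] times minus the square of the inverse: a product of factors which
    the induction already controls at order [k]. *)
Lemma Ck_inv k A (f : E -> R^o) : open A -> (forall x, A x -> f x != 0) ->
  Ck k A f -> Ck k A (fun x => (f x)^-1 : R^o).
Proof.
move=> oA f0; elim: k => [|k IH].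
  by move=> cf x Ax; exact: (cvgV (f0 _ Ax) (cf _ Ax)).
move=> Cf; have [df Df] := Cf; split=> [x Ax|v].
  exact: (differentiableV (df _ Ax) (f0 _ Ax)).
have Ci := IH (CkS Cf).
apply: Ck_eq (CkZ oA (Ck_cst k A (-1 : R^o)) (CkZ oA (CkZ oA Ci Ci) (Df v))) => //.
move=> x Ax; rewrite deriveV; [|exact: f0|exact/diff_derivable/df].
by rewrite !scalerA -exprVn mulN1r expr2.
Qed.

Lemma Ck_sqrt k A (f : E -> R^o) : open A -> (forall x, A x -> 0 < f x) ->
  Ck k A f -> Ck k A (fun x => Num.sqrt (f x) : R^o).
Proof.
move=> oA f0; elim: k => [|k IH].
  by move=> cf x Ax; apply: continuous_comp (cf _ Ax) _; exact: sqrt_continuous.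
move=> Cf; have [df Df] := Cf.
have ds x : A x -> differentiable (Num.sqrt : R^o -> R^o) (f x).
  move=> Ax; apply/derivable1_diffP.
  by have [] := is_derive1_sqrt (f0 _ Ax).
split=> [x Ax|v].
  exact: (differentiable_comp (df _ Ax) (ds _ Ax)).
have Ci := IH (CkS Cf).
have Ci2 : Ck k A (fun x => (2 *: (Num.sqrt (f x) : R^o))^-1 : R^o).
  apply: Ck_inv => //; first by move=> x Ax; rewrite mulf_neq0// sqrtr_eq0 -ltNge f0.
  exact: (CkZ oA (Ck_cst k A (2 : R^o)) Ci).
apply: Ck_eq (CkZ oA (Df v) Ci2) => // x Ax.
rewrite (derive_comp _ (df _ Ax) (ds _ Ax)).
(* The direction is the real number [d]; writing it as [d *: 1] reduces to the one-variable
   derivative of the square root. *)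
set d := 'D_v f x; rewrite [in RHS](_ : d = d *: (1 : R^o)); last by rewrite [RHS]mulr1.
rewrite [RHS](deriveE _ (ds _ Ax)) linearZ -(deriveE _ (ds _ Ax)).
by rewrite derive_sqrt ?f0.
Qed.

End CkTheory.

(** * Symmetry of second derivatives *)

Section Schwarz.
Variable R : realType.
Local Notation E := 'rV[R]_3.
Implicit Types (A : set E) (f : E -> R^o) (x y u v w : E).

Lemma MVT_line f y w (t : R) : 0 < t ->
  (forall s, 0 <= s <= t -> differentiable f (y + s *: w)) ->
  exists2 c, 0 < c < t & f (y + t *: w) - f y = t * 'D_w f (y + c *: w).
Proof.
move=> t0 df; pose h (s : R^o) : E := y + s *: w.
have dh s : differentiable h s.
  apply: differentiableD; first exact: differentiable_cst.
  by apply: differentiableZl.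
have Dh s : 'D_1 h s = w.
  rewrite /h deriveD; [|exact: derivable_cst|].
    rewrite derive_cst add0r.
    rewrite (@derive_scaler _ _ _ (id : R^o -> R^o) (fun=> w)) //.
    by rewrite derive_cst derive_id scaler0 add0r scale1r.
  by apply: diff_derivable; apply: differentiableZl.
have dfh s : 0 <= s <= t -> differentiable (f \o h) s.
  by move=> st; apply: differentiable_comp (dh s) (df _ st).
have [s||c] := @MVT _ (f \o h : R -> R) (fun s => 'D_w f (y + s *: w)) 0 t t0.
- rewrite in_itv /= => /andP[s0 st].
  have st' : 0 <= s <= t by rewrite !ltW.
  split; first exact: diff_derivable (dfh _ st').
  by rewrite (derive_comp _ (dh s) (df _ st')) Dh.
- apply: continuous_in_subspaceT => s; rewrite inE /= in_itv /= => st.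
  exact: differentiable_continuous (dfh _ st).
rewrite in_itv /= => ct; rewrite subr0 mulrC /h /= scale0r addr0 => fE.
by exists c.
Qed.

(** The second difference is symmetric in the two directions, and divided by [t ^+ 2] it
    approximates either mixed derivative, depending on the direction in which the mean value theorem
    is applied first. *)
Lemma schwarz A f x u v : open A -> A x -> Ck 2 A f ->
  'D_u ('D_v f) x = 'D_v ('D_u f) x.
Proof.
move=> oA Ax C2.
have df y : A y -> differentiable f y by move=> Ay; case: C2 => d _; exact: d.
have dD w y : A y -> differentiable ('D_w f) y.
  by move=> Ay; case: C2 => _ /(_ w)[d _]; exact: d.
have cD w w' : {for x, continuous ('D_w' ('D_w f))}.
  by case: C2 => _ /(_ w)[_ /(_ w')]; exact.
(* The second difference of [f] in the directions [u'] and [v']. *)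
have key u' v' e : 0 < e -> exists2 d, 0 < d & forall t, 0 < t < d ->
    `|(f (x + t *: u' + t *: v') - f (x + t *: u') - (f (x + t *: v') - f x)) / t ^+ 2
      - 'D_v' ('D_u' f) x| < e.
  move=> e0.
  have : \forall y \near x, A y /\ `|'D_v' ('D_u' f) x - 'D_v' ('D_u' f) y| < e.
    near=> y; split; near: y; first exact: open_nbhs_nbhs.
    by have /cvgrPdist_lt := cD u' v'; exact.
  move=> /nbhs_ballP[r /= r0 br].
  (* Points [x + a *: u' + b *: v'] with a and b between 0 and t are at distance at most t times the
     sum of the two norms from [x]. The added 1 keeps the divisor positive when both directions are
     zero. *)
  have b1 : 0 < `|u'| + `|v'| + 1 by rewrite ltr_wpDl// addr_ge0.
  exists (r / (`|u'| + `|v'| + 1)); first exact: divr_gt0.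
  move=> t /andP[t0]; rewrite ltr_pdivlMr// => tr.
  have inA a b : 0 <= a <= t -> 0 <= b <= t ->
      A (x + a *: u' + b *: v') /\
      `|'D_v' ('D_u' f) x - 'D_v' ('D_u' f) (x + a *: u' + b *: v')| < e.
    move=> /andP[a0 at_] /andP[b0 bt]; apply: br.
    rewrite -ball_normE /= -addrA opprD addNKr normrN.
    apply: le_lt_trans tr; apply: le_trans (ler_normD _ _) _.
    rewrite !normrZ !ger0_norm// mulrDr mulr1 ler_wpDr ?(ltW t0)// mulrDr.
    by rewrite lerD// ler_wpM2r.
  have tt : 0 <= t <= t by rewrite lexx ltW.
  have zt : 0 <= (0 : R) <= t by rewrite lexx ltW.
  (* The second difference of [f] is a first difference of [g] along [u']. A mean value along [u']
     leaves a first difference, along [v'], of a derivative of [f], to which the theorem applies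
     again. *)
  pose g y : R^o := f (y + t *: v') - f y.
  have dgs s : 0 <= s <= t -> differentiable (fun y => f (y + t *: v')) (x + s *: u').
    move=> st; apply: (@differentiable_comp _ _ _ _ (fun y => y + t *: v') f).
      by apply: differentiableD => //; exact: differentiable_cst.
    by apply: df; case: (inA s t st tt).
  have dfs s : 0 <= s <= t -> differentiable f (x + s *: u').
    by move=> st; apply: df; case: (inA s 0 st zt); rewrite scale0r addr0.
  have [|c /andP[c0 ct]] := @MVT_line g x u' t t0.
    by move=> s st; apply: differentiableB; [exact: dgs|exact: dfs].
  have ct' : 0 <= c <= t by rewrite !ltW.
  have -> : 'D_u' g (x + c *: u') =
      'D_u' f (x + c *: u' + t *: v') - 'D_u' f (x + c *: u').
    rewrite deriveB; [|exact/diff_derivable/dgs|exact/diff_derivable/dfs].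
    congr (_ - _).
    rewrite (@derive_comp _ _ _ _ (fun y => y + t *: v') f).
    - rewrite deriveD; [|exact: derivable_id|exact: derivable_cst].
      by rewrite derive_id derive_cst addr0.
    - by apply: differentiableD => //; exact: differentiable_cst.
    - by apply: df; case: (inA c t ct' tt).
  have [|c2 /andP[c20 c2t] ->] := @MVT_line ('D_u' f) (x + c *: u') v' t t0.
    by move=> s st; apply: dD; case: (inA c s ct' st).
  rewrite /g => ->.
  rewrite mulrA -expr2 mulrAC divff ?mul1r ?expf_neq0 ?gt_eqF// distrC.
  by case: (inA c c2 ct'); rewrite ?ltW.
apply/eqP; rewrite -subr_eq0 -normr_le0; apply/ler_addgt0Pl => e e0.
rewrite addr0.
have e2 : 0 < e / 2 by rewrite divr_gt0.
have [d1 d10 H1] := key u v _ e2; have [d2 d20 H2] := key v u _ e2.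
pose t := Num.min d1 d2 / 2.
have t0 : 0 < t by rewrite divr_gt0// lt_min d10.
have td : t < Num.min d1 d2 by rewrite ltr_pdivrMr// ltr_pMr ?ltr1n// lt_min d10.
move: td; rewrite lt_min => /andP[t1 t2].
have := H1 t; rewrite t0 t1 => /(_ isT) h1.
have := H2 t; rewrite t0 t2 => /(_ isT).
rewrite [x + t *: v + _]addrAC.
set a := _ - _ - _ in h1; set b := _ - _ - _.
have -> : b = a by rewrite /a /b; ring.
move=> h2.
rewrite [e]splitr -(subrKA (a / t ^+ 2)).
apply: le_trans (ler_normD _ _) _; apply: lerD; last exact: ltW h1.
by rewrite distrC; exact: ltW h2.
Unshelve. all: by end_near. Qed.

End Schwarz.

(** * Smooth functions on a manifold and their derivatives along fields *)

Lemma smooth_eq (R : realType) (W : normedModType R) (A : set 'rV[R]_3)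
    (f g : 'rV[R]_3 -> W) : open A -> (forall x, A x -> f x = g x) ->
  smooth A f -> smooth A g.
Proof. by move=> oA fg Cf k; exact: Ck_eq (Cf k). Qed.

Lemma smooth_sub (R : realType) (W : normedModType R) (A B : set 'rV[R]_3)
    (f : 'rV[R]_3 -> W) : B `<=` A -> smooth A f -> smooth B f.
Proof. by move=> BA Cf k; exact: Ck_sub (Cf k). Qed.

Lemma smooth_derive (R : realType) (W : normedModType R) (A : set 'rV[R]_3)
    (f : 'rV[R]_3 -> W) v : smooth A f -> smooth A ('D_v f).
Proof. by move=> Cf k; have [_] := Cf k.+1; exact. Qed.

Lemma smooth_differentiable (R : realType) (W : normedModType R)
    (A : set 'rV[R]_3) (f : 'rV[R]_3 -> W) x : smooth A f -> A x ->
  differentiable f x.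
Proof. by move=> Cf; have [df _] := Cf 1%N; exact: df. Qed.

Section SmoothFunctions.
Variables (R : realType) (M : manifold3 R).
Local Notation E := 'rV[R]_3.
Implicit Types (U V : set M) (X Y Z : M -> E) (phi psi : chart R M) (p q : M).

Lemma open_chart_image phi U : open U -> open (chart_image phi U).
Proof.
move=> oU; rewrite openE => x [tx Ux].
have tn : \forall y \near x, chart_tgt phi y.
  exact: (near_open (@chart_tgt_open _ _ phi) tx).
have Un : \forall y \near x, U (chart_inv phi y).
  by apply: (chart_inv_cont tx); exact: open_nbhs_nbhs.
exact: filterI tn Un.
Qed.

Lemma chart_imageP phi U p : chart_src phi p -> U p -> chart_image phi U (phi p).
Proof. by move=> sp Up; split; [exact: chart_map_tgt|rewrite chart_mapK]. Qed.

Lemma chart_image_sub phi U V : U `<=` V -> chart_image phi U `<=` chart_image phi V.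
Proof. by move=> UV x [tx /UV]. Qed.

Lemma chart_imageI phi U : chart_image phi U `<=` chart_image phi (U `&` chart_src phi).
Proof. by move=> x [tx Ux]; split=> //; split=> //; exact: chart_inv_src. Qed.

Section SmoothFun.
Variable W : normedModType R.
Implicit Types f g : M -> W.

Lemma smooth_fun_eq U f g : open U -> (forall p, U p -> f p = g p) ->
  smooth_fun U f -> smooth_fun U g.
Proof.
move=> oU fg Cf phi /Cf; apply: smooth_eq; first exact: open_chart_image.
by move=> x [_ Ux] /=; exact: fg.
Qed.

Lemma smooth_fun_sub U V f : V `<=` U -> smooth_fun U f -> smooth_fun V f.
Proof.
by move=> VU Cf phi /Cf; apply: smooth_sub; exact: chart_image_sub.
Qed.

Lemma smooth_fun_cst U (c : W) : smooth_fun U (fun=> c).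
Proof. by move=> phi _ k; exact: Ck_cst. Qed.

Lemma smooth_funD U f g : open U -> smooth_fun U f -> smooth_fun U g ->
  smooth_fun U (fun p => f p + g p).
Proof.
by move=> oU Cf Cg phi aphi k; apply: CkD (Cf _ aphi k) (Cg _ aphi k);
  exact: open_chart_image.
Qed.

Lemma smooth_funZ U (a : M -> R^o) f : open U -> smooth_fun U a ->
  smooth_fun U f -> smooth_fun U (fun p => a p *: f p).
Proof.
by move=> oU Cf Cg phi aphi k; apply: CkZ (Cf _ aphi k) (Cg _ aphi k);
  exact: open_chart_image.
Qed.

Lemma smooth_funN U f : open U -> smooth_fun U f -> smooth_fun U (fun p => - f p).
Proof.
by move=> oU Cf phi aphi k; apply: CkN (Cf _ aphi k); exact: open_chart_image.
Qed.

Lemma smooth_funB U f g : open U -> smooth_fun U f -> smooth_fun U g ->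
  smooth_fun U (fun p => f p - g p).
Proof. by move=> oU Cf Cg; apply: smooth_funD => //; exact: smooth_funN. Qed.

Lemma smooth_differentiable_at phi U f p : atlas phi -> chart_src phi p ->
  U p -> smooth_fun U f -> differentiable (f \o chart_inv phi) (phi p).
Proof.
by move=> aphi sp Up Cf; exact: smooth_differentiable (Cf _ aphi) (chart_imageP sp Up).
Qed.

End SmoothFun.

Lemma smooth_funM U (a b : M -> R^o) : open U -> smooth_fun U a ->
  smooth_fun U b -> smooth_fun U (fun p => a p * b p : R^o).
Proof. exact: smooth_funZ. Qed.

Lemma smooth_funV U (f : M -> R^o) : open U -> (forall p, U p -> f p != 0) ->
  smooth_fun U f -> smooth_fun U (fun p => (f p)^-1 : R^o).
Proof.
move=> oU f0 Cf phi aphi k; apply: Ck_inv (Cf _ aphi k).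
  exact: open_chart_image.
by move=> x [_ /f0].
Qed.

Lemma smooth_fun_sqrt U (f : M -> R^o) : open U -> (forall p, U p -> 0 < f p) ->
  smooth_fun U f -> smooth_fun U (fun p => Num.sqrt (f p) : R^o).
Proof.
move=> oU f0 Cf phi aphi k; apply: Ck_sqrt (Cf _ aphi k).
  exact: open_chart_image.
by move=> x [_ /f0].
Qed.

Lemma smooth_fun_coord U (f : M -> E) i : open U -> smooth_fun U f ->
  smooth_fun U (fun p => f p 0 i : R^o).
Proof.
by move=> oU Cf phi aphi k; apply: (@Ck_coord _ _ _ (f \o chart_inv phi));
  [exact: open_chart_image|exact: Cf].
Qed.

Lemma smooth_chart phi : atlas phi -> smooth_fun (chart_src phi) phi.
Proof. by move=> aphi psi apsi; exact: atlas_compatible. Qed.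

Lemma chart_at_differentiable (W : normedModType R) U (f : M -> W) p :
  U p -> smooth_fun U f -> differentiable (f \o chart_inv (chart_at p)) (chart_at p p).
Proof.
exact: smooth_differentiable_at (chart_at_atlas p) (chart_at_src p).
Qed.

Section Vderiv.
Variable W : normedModType R.
Implicit Types f g : M -> W.

(** This is the chain rule through the transition map. The factorisation holds only over the overlap
    of the two charts, which is open, and that suffices for a derivative. *)
Lemma derive_chart phi psi U f p v : open U -> U p -> atlas phi -> atlas psi ->
  chart_src phi p -> chart_src psi p -> smooth_fun U f ->
  'D_v (f \o chart_inv psi) (psi p) =
  'D_('D_v (phi \o chart_inv psi) (psi p)) (f \o chart_inv phi) (phi p).
Proof.
move=> oU Up aphi apsi sp psip Cf.
have E1 : phi p = (phi \o chart_inv psi) (psi p) by rewrite /= chart_mapK.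
have df := smooth_differentiable_at aphi sp Up Cf.
rewrite E1 -derive_comp.
- apply: (@eq_in_derive _ _ (chart_image psi (chart_src phi))).
  + exact/open_chart_image/(@chart_src_open _ _ phi).
  + exact: chart_imageP.
  + by move=> y [_ sy] /=; rewrite chart_mapK.
- exact: smooth_differentiable_at (smooth_chart aphi).
- by rewrite -E1.
Qed.

Lemma tderiv_chart phi U f p v : open U -> U p -> atlas phi -> chart_src phi p ->
  smooth_fun U f ->
  tderiv f p v = 'D_(tderiv phi p v) (f \o chart_inv phi) (phi p).
Proof.
move=> oU Up aphi sp Cf.
exact: derive_chart oU Up aphi (chart_at_atlas p) sp (chart_at_src p) Cf.
Qed.

Lemma continuous_smooth_fun U f p : open U -> U p -> smooth_fun U f ->
  {for p, continuous f}.
Proof.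
move=> oU Up Cf; set phi := chart_at p.
have sp : chart_src phi p := chart_at_src p.
apply: (@near_continuous_at _ _ ((f \o chart_inv phi) \o phi)).
  have : \forall q \near p, chart_src phi q.
    by apply: open_nbhs_nbhs; split=> //; exact: chart_src_open.
  by apply: filterS => q sq; rewrite /= chart_mapK.
apply: continuous_comp; first exact: chart_map_cont.
exact: (Cf _ (chart_at_atlas p) 0%N) (chart_imageP sp Up).
Qed.

Lemma vderiv_eq U X f g p : open U -> U p -> (forall q, U q -> f q = g q) ->
  vderiv X f p = vderiv X g p.
Proof.
move=> oU Up fg; apply: (@eq_in_derive _ _ (chart_image (chart_at p) U)).
- exact: open_chart_image.
- exact/chart_imageP/Up/chart_at_src.
- by move=> y [_ Uy]; exact: fg.
Qed.

Lemma vderiv_cst X (c : W) p : vderiv X (fun=> c) p = 0.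
Proof. exact: derive_cst. Qed.

Lemma vderivD U X f g p : U p -> smooth_fun U f -> smooth_fun U g ->
  vderiv X (fun q => f q + g q) p = vderiv X f p + vderiv X g p.
Proof.
by move=> Up Cf Cg; apply: deriveD; apply: diff_derivable; exact: chart_at_differentiable Up _.
Qed.

Lemma vderivZ U X (a : M -> R^o) f p : U p -> smooth_fun U a -> smooth_fun U f ->
  vderiv X (fun q => a q *: f q) p = a p *: vderiv X f p + vderiv X a p *: f p.
Proof.
move=> Up Ca Cf; rewrite /vderiv /tderiv.
rewrite (@derive_scaler _ _ _ (a \o _) (f \o _)) /=.
- by rewrite chart_mapK//; exact: chart_at_src.
- exact: chart_at_differentiable Up _.
- exact: chart_at_differentiable Up _.
Qed.

Lemma vderivDl U X Y f p (a : M -> R) : U p -> smooth_fun U f ->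
  vderiv (fun q => a q *: X q + Y q) f p = a p *: vderiv X f p + vderiv Y f p.
Proof.
by move=> Up Cf; rewrite /vderiv /tderiv deriveDl//; exact: chart_at_differentiable Up _.
Qed.

(** The chart behind [vderiv X f] changes with the point. In a fixed chart [phi] the derivative
    becomes a combination of partial derivatives of [f] whose coefficients are the components of
    [vderiv X phi], and all these factors are smooth. *)
Lemma smooth_vderiv U X f : open U -> smooth_vfield U X -> smooth_fun U f ->
  smooth_fun U (vderiv X f).
Proof.
move=> oU CX Cf phi aphi k.
have oA := @open_chart_image phi U oU.
pose e i : E := delta_mx 0 i.
apply: (@Ck_eq _ _ k _ (fun x => \sum_(i < 3)
  (vderiv X phi (chart_inv phi x) 0 i : R^o) *: 'D_(e i) (f \o chart_inv phi) x)) => //.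
  move=> x [tx Ux] /=; rewrite /vderiv.
  rewrite (tderiv_chart _ oU Ux aphi (chart_inv_src tx) Cf) chart_invK//.
  rewrite {2}[tderiv _ _ _]row_sum_delta derive_linear//.
  by apply: smooth_differentiable (Cf _ aphi) _.
apply: Ck_sum => // i; apply: CkZ => //; last exact: smooth_derive (Cf _ aphi) _.
apply: (@Ck_coord _ _ _ (vderiv X phi \o chart_inv phi)) => //.
exact: Ck_sub (chart_imageI (U := U)) (CX _ aphi _ aphi k).
Qed.

End Vderiv.
End SmoothFunctions.

(** * Smooth vector fields and second derivatives along them *)

Section VectorFields.
Variables (R : realType) (M : manifold3 R).
Local Notation E := 'rV[R]_3.
Implicit Types (U V : set M) (X Y Z : M -> E) (phi psi : chart R M) (p q : M).

Lemma open_setI_chart U phi : open U -> open (U `&` chart_src phi).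
Proof. by move=> oU; apply: openI => //; exact: chart_src_open. Qed.

Lemma smooth_vfield_sub U V X : V `<=` U -> smooth_vfield U X -> smooth_vfield V X.
Proof.
move=> VU CX phi aphi; apply: smooth_fun_sub (CX _ aphi).
by move=> p [/VU].
Qed.

Lemma smooth_vfield_eq U X Y : open U -> (forall p, U p -> X p = Y p) ->
  smooth_vfield U X -> smooth_vfield U Y.
Proof.
move=> oU XY CX phi aphi; apply: smooth_fun_eq (CX _ aphi).
  exact: open_setI_chart.
by move=> p [/XY e _]; rewrite /vderiv e.
Qed.

Lemma smooth_vfield_lin U (a : M -> R^o) X Y : open U -> smooth_fun U a ->
  smooth_vfield U X -> smooth_vfield U Y -> smooth_vfield U (fun p => a p *: X p + Y p).
Proof.
move=> oU Ca CX CY phi aphi.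
have oUp := @open_setI_chart U phi oU.
apply: (smooth_fun_eq oUp (f := fun p => a p *: vderiv X phi p + vderiv Y phi p)).
  move=> p [Up sp]; rewrite (@vderivDl _ _ _ (chart_src phi))//.
  exact: smooth_chart.
apply: smooth_funD => //; last exact: CY.
apply: smooth_funZ => //; last exact: CX.
by apply: smooth_fun_sub Ca => p [].
Qed.

Lemma vderiv0 (W : normedModType R) (f : M -> W) p : vderiv (fun=> 0) f p = 0.
Proof. exact: derive0. Qed.

Lemma smooth_vfield0 U : open U -> smooth_vfield U (fun=> 0).
Proof.
move=> oU phi aphi; apply: (smooth_fun_eq (f := fun=> 0)).
- exact: open_setI_chart.
- by move=> p _; rewrite vderiv0.
- exact: smooth_fun_cst.
Qed.

Lemma smooth_vfieldZ U (a : M -> R^o) X : open U -> smooth_fun U a ->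
  smooth_vfield U X -> smooth_vfield U (fun p => a p *: X p).
Proof.
move=> oU Ca CX.
apply: smooth_vfield_eq (smooth_vfield_lin oU Ca CX (smooth_vfield0 oU)) => //.
by move=> p _; rewrite addr0.
Qed.

Lemma vderivE_coord U X (f : M -> E) p i : U p -> smooth_fun U f ->
  (vderiv X f p) 0 i = vderiv X ((fun q => f q 0 i) : M -> R^o) p.
Proof.
move=> Up Cf; rewrite /vderiv /tderiv.
have := @derive_linear_comp _ _ _ _ (@coordinate R i) (f \o chart_inv (chart_at p))
  (chart_at p p) (X p) (@continuous_coordinate _ i).
by move=> H; apply/esym/H; exact: chart_at_differentiable Up _.
Qed.

Lemma vderiv_chart_at X p : vderiv X (chart_at p) p = X p.
Proof.
rewrite -[RHS](derive_id (chart_at p p)); apply: eq_in_derive.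
- exact: (@chart_tgt_open _ _ (chart_at p)).
- exact/chart_map_tgt/chart_at_src.
- by move=> y ty /=; rewrite chart_invK.
Qed.

Lemma vderiv_sum_basis (W : normedModType R) U X (f : M -> W) p : U p -> smooth_fun U f ->
  vderiv X f p = \sum_(i < 3) X p 0 i *: tderiv f p (delta_mx 0 i).
Proof.
move=> Up Cf; rewrite /vderiv /tderiv [X in 'D_X _ _]row_sum_delta derive_linear//.
exact: chart_at_differentiable Up _.
Qed.

Lemma tderivB (W : normedModType R) U (f : M -> W) p u v : U p -> smooth_fun U f ->
  tderiv f p (u - v) = tderiv f p u - tderiv f p v.
Proof.
move=> Up Cf; have df := chart_at_differentiable Up Cf.
by rewrite /tderiv !(deriveE _ df) linearB.
Qed.

(** X(Y f) splits into a first-order term and a Hessian term. When X and Y are exchanged, the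
    first-order terms differ by the bracket and the Hessian terms agree by [schwarz], whence the
    commutator formula for scalar functions. *)
Lemma vderiv_vderiv (W : normedModType R) U X Y (f : M -> W) p : open U -> U p ->
  smooth_vfield U X -> smooth_vfield U Y -> smooth_fun U f ->
  vderiv X (vderiv Y f) p = tderiv f p (vderiv X (vderiv Y (chart_at p)) p) +
    \sum_(i < 3) \sum_(j < 3) (Y p 0 i * X p 0 j) *:
       'D_(delta_mx 0 j) ('D_(delta_mx 0 i) (f \o chart_inv (chart_at p))) (chart_at p p).
Proof.
move=> oU Up CX CY Cf; set psi := chart_at p.
have apsi : atlas psi := chart_at_atlas p.
have psip : chart_src psi p := chart_at_src p.
(* [eta] holds the components of [Y] in the one chart [psi], and so can be differentiated, unlike
   [Y], whose components refer to a moving chart. *)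
set F := f \o _; pose eta := vderiv Y psi \o chart_inv psi.
pose A := chart_image psi U.
have oA : open A by exact: open_chart_image.
have Ax : A (psi p) by exact: chart_imageP.
have CF : smooth A F by exact: Cf.
have Ce : smooth A eta.
  by apply: smooth_sub (CY _ apsi _ apsi); exact: chart_imageI.
have de i : differentiable ((fun x => eta x 0 i) : E -> R^o) (psi p).
  by apply: smooth_differentiable Ax => k; exact: Ck_coord.
have dF i : differentiable ('D_(delta_mx 0 i) F) (psi p).
  by apply: smooth_differentiable Ax; exact: smooth_derive.
have YfE x : A x -> (vderiv Y f \o chart_inv psi) x =
    \sum_(i < 3) (eta x 0 i : R^o) *: 'D_(delta_mx 0 i) F x.
  move=> Axx; have [tx Ux] := Axx; rewrite /= /vderiv.
  rewrite (tderiv_chart _ oU Ux apsi (chart_inv_src tx) Cf) chart_invK//.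
  rewrite {1}[tderiv _ _ _]row_sum_delta derive_linear//.
  exact: smooth_differentiable CF Axx.
have etap : eta (psi p) = Y p by rewrite /eta /= chart_mapK// vderiv_chart_at.
rewrite {1}/vderiv {1}/tderiv (eq_in_derive _ oA Ax YfE).
rewrite -/psi.
have -> : (fun x => \sum_(i < 3) (eta x 0 i : R^o) *: 'D_(delta_mx 0 i) F x) =
    \sum_(i < 3) (fun x => (eta x 0 i : R^o) *: 'D_(delta_mx 0 i) F x).
  by apply/funext => x; rewrite fct_sumE.
rewrite derive_sum; last first.
  by move=> i; apply: diff_derivable; exact: differentiable_scaler.
under eq_bigr => i _ do rewrite derive_scaler//.
rewrite big_split /= addrC; congr (_ + _).
  rewrite /tderiv -/psi -/F [in RHS](row_sum_delta (vderiv X _ p)).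
  rewrite derive_linear; last exact: smooth_differentiable CF Ax.
  apply: eq_bigr => i _; congr (_ *: _).
  by rewrite (@vderivE_coord (U `&` chart_src psi) X (vderiv Y psi) p i)//; exact: CY.
apply: eq_bigr => i _; rewrite etap.
rewrite {1}(row_sum_delta (X p)) derive_linear// scaler_sumr.
by apply: eq_bigr => j _; rewrite scalerA.
Qed.

Lemma bracket_vderiv U X Y (f : M -> R^o) p : open U -> U p ->
  smooth_vfield U X -> smooth_vfield U Y -> smooth_fun U f ->
  vderiv (bracket X Y) f p = vderiv X (vderiv Y f) p - vderiv Y (vderiv X f) p.
Proof.
move=> oU Up CX CY Cf.
have oA : open (chart_image (chart_at p) U) by exact: open_chart_image.
have Ax : chart_image (chart_at p) U (chart_at p p).
  exact/chart_imageP/Up/chart_at_src.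
have C2 : Ck 2 (chart_image (chart_at p) U) (f \o chart_inv (chart_at p)).
  exact: (Cf _ (chart_at_atlas p) 2%N).
rewrite (vderiv_vderiv oU Up CX CY Cf) (vderiv_vderiv oU Up CY CX Cf).
rewrite [X in _ - (_ + X)]exchange_big /=.
under [X in _ - (_ + X)]eq_bigr => i _ do
  under eq_bigr => j _ do rewrite [X in X *: _]mulrC (schwarz _ _ oA Ax C2).
have addK2 (a b s : R^o) : a + s - (b + s) = a - b.
  by rewrite opprD addrACA subrr addr0.
exact: etrans (tderivB _ _ Up Cf) (esym (addK2 _ _ _)).
Qed.

Lemma vderiv_at (W : normedModType R) X Y (f : M -> W) p : X p = Y p ->
  vderiv X f p = vderiv Y f p.
Proof. by rewrite /vderiv => ->. Qed.

Lemma vderivN (W : normedModType R) U X (f : M -> W) p : U p -> smooth_fun U f ->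
  vderiv X (fun q => - f q) p = - vderiv X f p.
Proof.
by move=> Up Cf; apply: deriveN; apply: diff_derivable; exact: chart_at_differentiable Up _.
Qed.

End VectorFields.

(* Sealed copies: comparing two distinct directional derivatives would
   otherwise make unification unfold both of them. *)
HB.lock Definition lderiv (R : realType) (M : manifold3 R) (W : normedModType R)
  (X : M -> 'rV[R]_3) (f : M -> W) : M -> W := vderiv X f.
HB.lock Definition lbracket (R : realType) (M : manifold3 R)
  (X Y : M -> 'rV[R]_3) : M -> 'rV[R]_3 := bracket X Y.

(** * Calculus rules for the sealed derivative and bracket *)

Section LieDerivative.
Variables (R : realType) (M : manifold3 R).
Local Notation E := 'rV[R]_3.
Implicit Types (U V : set M) (X Y Z : M -> E) (phi psi : chart R M) (p q : M).

Section Values.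
Variable W : normedModType R.
Implicit Types f g : M -> W.

Lemma vderivE X f : vderiv X f = lderiv X f.
Proof. by rewrite lderiv.unlock. Qed.

Lemma lderiv_eq U X Y f g p : open U -> U p -> X p = Y p ->
  (forall q, U q -> f q = g q) -> lderiv X f p = lderiv Y g p.
Proof.
by rewrite lderiv.unlock => oU Up XY fg; rewrite (vderiv_eq X oU Up fg); exact: vderiv_at.
Qed.

Lemma lderiv_cst X (c : W) p : lderiv X (fun=> c) p = 0.
Proof. by rewrite lderiv.unlock; exact: vderiv_cst. Qed.

Lemma lderivD U X f g p : U p -> smooth_fun U f -> smooth_fun U g ->
  lderiv X (fun q => f q + g q) p = lderiv X f p + lderiv X g p.
Proof. by rewrite lderiv.unlock; exact: vderivD. Qed.

Lemma lderivN U X f p : U p -> smooth_fun U f ->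
  lderiv X (fun q => - f q) p = - lderiv X f p.
Proof. by rewrite lderiv.unlock; exact: vderivN. Qed.

Lemma lderivB U X f g p : open U -> U p -> smooth_fun U f -> smooth_fun U g ->
  lderiv X (fun q => f q - g q) p = lderiv X f p - lderiv X g p.
Proof.
move=> oU Up Cf Cg; rewrite -(lderivN X Up Cg); apply: (lderivD X Up Cf).
exact: smooth_funN.
Qed.

Lemma lderivZ U X (a : M -> R^o) f p : U p -> smooth_fun U a -> smooth_fun U f ->
  lderiv X (fun q => a q *: f q) p = a p *: lderiv X f p + lderiv X a p *: f p.
Proof. by rewrite !lderiv.unlock; exact: vderivZ. Qed.

Lemma lderivDl U X Y f p (a : M -> R) : U p -> smooth_fun U f ->
  lderiv (fun q => a q *: X q + Y q) f p = a p *: lderiv X f p + lderiv Y f p.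
Proof. by rewrite lderiv.unlock; exact: vderivDl. Qed.

Lemma smooth_lderiv U X f : open U -> smooth_vfield U X -> smooth_fun U f ->
  smooth_fun U (lderiv X f).
Proof. by rewrite lderiv.unlock; exact: smooth_vderiv. Qed.

End Values.

Lemma lderivM U X (a b : M -> R^o) p : U p -> smooth_fun U a -> smooth_fun U b ->
  lderiv X ((fun q => a q * b q) : M -> R^o) p =
  a p * lderiv X b p + lderiv X a p * b p.
Proof. exact: lderivZ. Qed.

Lemma lderiv_coord U X (f : M -> E) p i : U p -> smooth_fun U f ->
  (lderiv X f p) 0 i = lderiv X ((fun q => f q 0 i) : M -> R^o) p.
Proof. by rewrite !lderiv.unlock; exact: vderivE_coord. Qed.

Lemma lderiv_chart_at X p : lderiv X (chart_at p) p = X p.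
Proof. by rewrite lderiv.unlock; exact: vderiv_chart_at. Qed.

Lemma smooth_lderiv_chart U X phi : atlas phi -> smooth_vfield U X ->
  smooth_fun (U `&` chart_src phi) (lderiv X phi).
Proof. by rewrite lderiv.unlock => aphi; exact. Qed.

Lemma lderiv_lbracket U X Y (f : M -> R^o) p : open U -> U p ->
  smooth_vfield U X -> smooth_vfield U Y -> smooth_fun U f ->
  lderiv (lbracket X Y) f p = lderiv X (lderiv Y f) p - lderiv Y (lderiv X f) p.
Proof. by rewrite lderiv.unlock lbracket.unlock; exact: bracket_vderiv. Qed.

Lemma bracketE X Y : bracket X Y = lbracket X Y.
Proof. by rewrite lbracket.unlock. Qed.

Lemma lbracket_chart_at X Y p : lbracket X Y p =
  lderiv X (lderiv Y (chart_at p)) p - lderiv Y (lderiv X (chart_at p)) p.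
Proof. by rewrite !lderiv.unlock lbracket.unlock. Qed.

End LieDerivative.

(** * Leibniz rule and Jacobi identity for the bracket *)

Section LieBracket.
Variables (R : realType) (M : manifold3 R).
Local Notation E := 'rV[R]_3.
Implicit Types (U V : set M) (X Y Z : M -> E) (phi psi : chart R M) (p q : M).

(** Brackets are defined by their action on chart maps, which are row-valued, while the commutator
    formula is scalar; the passage is made coordinate by coordinate. *)
Lemma lderiv_lbracket_row U X Y (f : M -> E) p : open U -> U p ->
  smooth_vfield U X -> smooth_vfield U Y -> smooth_fun U f ->
  lderiv (lbracket X Y) f p = lderiv X (lderiv Y f) p - lderiv Y (lderiv X f) p.
Proof.
move=> oU Up CX CY Cf; apply/rowP => i; rewrite [RHS]mxE [X in _ + X]mxE.
have Cfi : smooth_fun U ((fun q => f q 0 i) : M -> R^o) by exact: smooth_fun_coord.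
have CYf := smooth_lderiv oU CY Cf; have CXf := smooth_lderiv oU CX Cf.
rewrite (lderiv_coord (lbracket X Y) i Up Cf) (lderiv_coord X i Up CYf).
rewrite (lderiv_coord Y i Up CXf) (lderiv_lbracket oU Up CX CY Cfi).
congr (_ - _); apply: (lderiv_eq oU Up) => // q Uq.
  by rewrite (lderiv_coord Y i Uq Cf).
by rewrite (lderiv_coord X i Uq Cf).
Qed.

(** By the commutator formula the components of the bracket are X(Y phi) - Y(X phi) in every chart
    [phi], although the definition uses only the chart selected at each point. *)
Lemma smooth_lbracket U X Y : open U -> smooth_vfield U X -> smooth_vfield U Y ->
  smooth_vfield U (lbracket X Y).
Proof.
move=> oU CX CY phi aphi; rewrite vderivE.
have oV := @open_setI_chart _ _ U phi oU.
have CX' : smooth_vfield (U `&` chart_src phi) X.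
  by apply: smooth_vfield_sub CX => ? [].
have CY' : smooth_vfield (U `&` chart_src phi) Y.
  by apply: smooth_vfield_sub CY => ? [].
apply: (smooth_fun_eq oV (f := fun p => lderiv X (lderiv Y phi) p - lderiv Y (lderiv X phi) p)).
  move=> p Vp; rewrite (lderiv_lbracket_row oV Vp)//.
  by apply: smooth_fun_sub (smooth_chart aphi) => ? [].
by apply: smooth_funB => //; apply: smooth_lderiv => //; exact: smooth_lderiv_chart.
Qed.

Lemma lbracketC X Y p : lbracket X Y p = - lbracket Y X p.
Proof. by rewrite !lbracket_chart_at opprB. Qed.

Lemma lbracketxx X p : lbracket X X p = 0.
Proof. by rewrite lbracket_chart_at subrr. Qed.

Lemma lbracket_eq U X X' Y Y' p : open U -> U p ->
  (forall q, U q -> X q = X' q) -> (forall q, U q -> Y q = Y' q) ->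
  lbracket X Y p = lbracket X' Y' p.
Proof.
move=> oU Up XX YY; rewrite !lbracket_chart_at.
congr (_ - _); apply: (lderiv_eq oU Up) => [|q Uq]; [exact: XX| |exact: YY|].
  exact: (lderiv_eq oU Uq (YY _ Uq)).
exact: (lderiv_eq oU Uq (XX _ Uq)).
Qed.

Lemma lbracket_linr U (a : M -> R^o) X Y Z p : open U -> U p -> smooth_fun U a ->
  smooth_vfield U X -> smooth_vfield U Y -> smooth_vfield U Z ->
  lbracket X (fun q => a q *: Y q + Z q) p =
  a p *: lbracket X Y p + lderiv X a p *: Y p + lbracket X Z p.
Proof.
move=> oU Up Ca CX CY CZ; set psi := chart_at p.
have apsi : atlas psi := chart_at_atlas p.
have oV := @open_setI_chart _ _ U psi oU.
have Vp : (U `&` chart_src psi) p by split=> //; exact: chart_at_src.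
have Cpsi := smooth_chart apsi.
have Ca' : smooth_fun (U `&` chart_src psi) a by apply: smooth_fun_sub Ca => ? [].
have CVX := smooth_lderiv_chart apsi CX.
have CVY := smooth_lderiv_chart apsi CY; have CVZ := smooth_lderiv_chart apsi CZ.
rewrite !lbracket_chart_at -/psi.
rewrite (@lderiv_eq _ _ _ _ X X _
  (fun q => a q *: lderiv Y psi q + lderiv Z psi q) p oV Vp erefl); last first.
  by move=> q [_ sq]; rewrite (lderivDl _ _ _ sq Cpsi).
rewrite (lderivD X Vp (smooth_funZ oV Ca' CVY) CVZ) (lderivZ X Vp Ca' CVY).
rewrite (lderivDl _ _ _ Vp CVX) lderiv_chart_at scalerBr opprD.
by rewrite -!addrA; congr (_ + _); rewrite [RHS]addrCA; congr (_ + _); rewrite addrCA.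
Qed.

(** Evaluated on the chart map at [p], each double bracket is an alternating sum of four triple
    derivatives, and the twelve terms cancel in pairs. *)
Lemma jacobi U X Y Z p : open U -> U p ->
  smooth_vfield U X -> smooth_vfield U Y -> smooth_vfield U Z ->
  lbracket X (lbracket Y Z) p + lbracket Y (lbracket Z X) p + lbracket Z (lbracket X Y) p = 0.
Proof.
move=> oU Up CX CY CZ; set psi := chart_at p.
have apsi : atlas psi := chart_at_atlas p.
pose V := U `&` chart_src psi.
have oV : open V := @open_setI_chart _ _ U psi oU.
have Vp : V p by split=> //; exact: chart_at_src.
have Cpsi : smooth_fun V psi by apply: smooth_fun_sub (smooth_chart apsi) => ? [].
have VU : V `<=` U by move=> ? [].
have main X' Y' Z' : smooth_vfield U X' -> smooth_vfield U Y' -> smooth_vfield U Z' ->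
    lbracket X' (lbracket Y' Z') p =
    lderiv X' (lderiv Y' (lderiv Z' psi)) p - lderiv X' (lderiv Z' (lderiv Y' psi)) p
    - (lderiv Y' (lderiv Z' (lderiv X' psi)) p - lderiv Z' (lderiv Y' (lderiv X' psi)) p).
  move=> CX' CY' CZ'.
  have S T : smooth_vfield U T -> smooth_vfield V T by exact: smooth_vfield_sub.
  have CVX : smooth_fun V (lderiv X' psi) by exact: smooth_lderiv_chart.
  have CVY : smooth_fun V (lderiv Y' psi) by exact: smooth_lderiv_chart.
  have CVZ : smooth_fun V (lderiv Z' psi) by exact: smooth_lderiv_chart.
  rewrite {1}lbracket_chart_at -/psi.
  rewrite (@lderiv_eq _ _ _ _ X' X' _
    (fun q => lderiv Y' (lderiv Z' psi) q - lderiv Z' (lderiv Y' psi) q) p oV Vp erefl); last first.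
    by move=> q Vq; rewrite (lderiv_lbracket_row oV Vq (S _ CY') (S _ CZ') Cpsi).
  rewrite (lderiv_lbracket_row oV Vp (S _ CY') (S _ CZ') CVX); congr (_ - _).
  have CYZ := smooth_lderiv oV (S _ CY') CVZ.
  have CZY := smooth_lderiv oV (S _ CZ') CVY.
  exact: lderivB oV Vp CYZ CZY.
rewrite !main//; apply/rowP => i; rewrite !mxE; ring.
Qed.

End LieBracket.

(** * Coordinate fields of a chart *)

Section CoordinateFields.
Variables (R : realType) (M : manifold3 R).
Local Notation E := 'rV[R]_3.
Implicit Types (U V : set M) (X Y Z : M -> E) (phi psi : chart R M) (p q : M).

Lemma lderiv_coord_vfield (W : normedModType R) U (f : M -> W) p q i :
  open U -> U q -> chart_src (chart_at p) q -> smooth_fun U f ->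
  lderiv (coord_vfield p i) f q =
  'D_(delta_mx 0 i) (f \o chart_inv (chart_at p)) (chart_at p q).
Proof.
move=> oU Uq sq Cf; rewrite -vderivE; apply/esym.
exact: derive_chart oU Uq (chart_at_atlas q) (chart_at_atlas p) (chart_at_src q) sq Cf.
Qed.

(** The components in another chart are partial derivatives of the transition map. *)
Lemma smooth_coord_vfield p i : smooth_vfield (chart_src (chart_at p)) (coord_vfield p i).
Proof.
move=> phi aphi; rewrite vderivE; set psi := chart_at p.
have apsi : atlas psi := chart_at_atlas p.
have opsi : open (chart_src psi) by exact: chart_src_open.
have ophi : open (chart_src phi) by exact: chart_src_open.
have oI := openI opsi ophi.
apply: (smooth_fun_eq oI
  (f := fun q => 'D_(delta_mx 0 i) (phi \o chart_inv psi) (psi q))).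
  move=> q [s1 s2]; rewrite (lderiv_coord_vfield _ ophi s2 s1)//.
  exact: smooth_chart.
move=> chi achi k.
apply: (@Ck_comp _ _ _ _ (chart_image psi (chart_src phi))
  ('D_(delta_mx 0 i) (phi \o chart_inv psi)) (psi \o chart_inv chi)).
- exact: open_chart_image.
- exact: open_chart_image.
- by move=> x [tx [s1 s2]]; exact: chart_imageP.
- exact: smooth_derive (atlas_compatible apsi aphi) k.
- apply: Ck_sub (atlas_compatible achi apsi k).
  by move=> x [tx [s1 s2]].
Qed.

Lemma coord_vfield_at p i : coord_vfield p i p = delta_mx 0 i.
Proof.
have := lderiv_chart_at (coord_vfield p i) p.
rewrite (lderiv_coord_vfield _ (@chart_src_open _ _ (chart_at p)))//.
- by move=> <-; have := lderiv_chart_at (fun=> delta_mx 0 i) p; rewrite -vderivE.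
- exact: chart_at_src.
- exact: chart_at_src.
- exact: smooth_chart (chart_at_atlas p).
Qed.

Lemma open_pos U (f : M -> R^o) : open U -> smooth_fun U f ->
  open (U `&` [set q | 0 < f q]).
Proof.
move=> oU Cf; rewrite openE => q [Uq fq]; apply: filterI.
  exact: open_nbhs_nbhs.
have := continuous_smooth_fun oU Uq Cf.
by move/cvgr_gt => /(_ _ fq).
Qed.

Lemma form_eval_lin (a : M -> 'cV[R]_3) (c : M -> R) X Y p :
  form_eval a (fun q => c q *: X q + Y q) p = c p * form_eval a X p + form_eval a Y p.
Proof. by rewrite /form_eval mulmxDl -scalemxAl !mxE. Qed.

Lemma lbracket_linl U (a : M -> R^o) X Y Z p : open U -> U p -> smooth_fun U a ->
  smooth_vfield U X -> smooth_vfield U Y -> smooth_vfield U Z ->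
  lbracket (fun q => a q *: Y q + Z q) X p =
  a p *: lbracket Y X p - lderiv X a p *: Y p + lbracket Z X p.
Proof.
move=> oU Up Ca CX CY CZ; rewrite lbracketC (lbracket_linr oU)// !opprD.
by rewrite -scalerN -!lbracketC.
Qed.

End CoordinateFields.

(** * Local orthonormal frames of the distribution *)

Section ContactFrames.
Variables (R : realType) (M : manifold3 R) (S : contact_structure M).
Local Notation E := 'rV[R]_3.
Implicit Types (U V : set M) (X Y Z : M -> E) (p q : M).

(** The value of [g] on the pair (X1, X1), the only place where the two signatures differ in an
    orthonormal frame. *)
Definition frame_sign : R :=
  match cs_kind S with SubRiemannian => 1 | SubLorentzian => -1 end.

Local Notation eps := frame_sign.
Local Notation g := (@cs_g R M S).
Local Notation D := (@cs_D R M S).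

Lemma frame_signP : eps = 1 \/ eps = -1.
Proof. by rewrite /eps; case: cs_kind; [left|right]. Qed.

Lemma frame_sign2 : eps * eps = 1.
Proof. by rewrite /eps; case: cs_kind; ring. Qed.

Lemma frame_sign_neq0 : eps != 0.
Proof. by apply/eqP => e0; have /eqP := frame_sign2; rewrite e0 mul0r eq_sym oner_eq0. Qed.

Lemma cs_linearr p (a : R) u u' v : u \in D p -> u' \in D p -> v \in D p ->
  g p v (a *: u + u') = a * g p v u + g p v u'.
Proof.
move=> uD u'D vD; rewrite cs_sym// ?memvD ?memvZ// cs_linear//.
by rewrite cs_sym// [g p u' _]cs_sym.
Qed.

Lemma cs_g0l p v : v \in D p -> g p 0 v = 0.
Proof.
move=> vD; have := cs_linear (-1) (mem0v (D p)) (mem0v (D p)) vD.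
by rewrite scaler0 addr0 mulN1r addNr.
Qed.

Lemma cs_gZl p (a : R) u v : u \in D p -> v \in D p -> g p (a *: u) v = a * g p u v.
Proof.
move=> uD vD; have := cs_linear a uD (mem0v (D p)) vD.
by rewrite addr0 cs_g0l// addr0.
Qed.

Lemma cs_gZr p (a : R) u v : u \in D p -> v \in D p -> g p u (a *: v) = a * g p u v.
Proof. by move=> uD vD; rewrite cs_sym ?memvZ// cs_gZl// cs_sym. Qed.

Lemma section_lin U (a : M -> R^o) X Y : open U -> smooth_fun U a ->
  section_on D U X -> section_on D U Y ->
  section_on D U (fun p => a p *: X p + Y p).
Proof.
move=> oU Ca [CX DX] [CY DY]; split; first exact: smooth_vfield_lin.
by move=> p Up; rewrite memvD ?memvZ ?DX ?DY.
Qed.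

Lemma section_Z U (a : M -> R^o) X : open U -> smooth_fun U a ->
  section_on D U X -> section_on D U (fun p => a p *: X p).
Proof.
move=> oU Ca [CX DX]; split; first exact: smooth_vfieldZ.
by move=> p Up; rewrite memvZ ?DX.
Qed.

Lemma section_sub U V X : V `<=` U -> section_on D U X -> section_on D V X.
Proof.
move=> VU [CX DX]; split; first exact: smooth_vfield_sub CX.
by move=> p /VU; exact: DX.
Qed.

(** In Lorentzian signature an arbitrary local frame may begin with a null vector, on which
    Gram-Schmidt fails. An orthogonal basis with the right signs at the single point [p] is
    therefore found first; the strict signs are open conditions and persist nearby. *)
Lemma orthogonal_basis p : exists u v, [/\ u \in D p, v \in D p,
  0 < eps * g p u u, 0 < g p v v & g p u v = 0].
Proof.
have := @cs_signature _ _ S p; rewrite /eps; case: cs_kind; last first.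
  move=> [u [v [uD vD gu gv guv]]]; exists u, v; split=> //; last by rewrite gv.
  by rewrite gu mulrNN mulr1.
move=> pos.
have [dim2 loc] := cs_distribution S.
have [U [X [Y [oU Up CX CY DE]]]] := loc p.
have Dp := DE _ Up.
have XD : X p \in D p by rewrite Dp memv_span// mem_head.
have YD : Y p \in D p by rewrite Dp memv_span// inE mem_head orbT.
(* A plane lies in no line; this prevents either Gram-Schmidt vector from being zero. *)
have nodim1 u : (D p <= <[u]>)%VS -> False.
  by move=> /dimvS; rewrite dim2 dim_vline; case: (u != 0).
have X0 : X p != 0.
  apply/eqP => X0; apply: (nodim1 (Y p)); rewrite Dp X0.
  by rewrite span_cons span_seq1 subv_add subvv -memvE mem0v.
have gX := pos _ XD X0.
pose c := g p (Y p) (X p) / g p (X p) (X p).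
have vD : (- c) *: X p + Y p \in D p by rewrite memvD ?memvZ.
exists (X p), ((- c) *: X p + Y p); split=> //.
- by rewrite mul1r.
- apply: pos => //; apply/eqP => v0; apply: (nodim1 (X p)).
  have -> : D p = <<[:: X p; Y p]>>%VS by [].
  have -> : Y p = c *: X p.
    by apply/eqP; rewrite -subr_eq0 addrC -scaleNr v0.
  rewrite span_cons span_seq1 subv_add subvv /= -memvE.
  by rewrite memvZ ?memv_line.
- rewrite cs_linearr// /c mulNr divfK ?gt_eqF// cs_sym// addNr //.
Qed.

(** The basis at [p] is extended by combinations of a local frame with constant coefficients.
    Gram-Schmidt then runs on the neighbourhood where the signs persist, which shrinks once for each
    vector to be normalised. *)
Lemma orthonormal_frame p : exists U X Y, [/\ open U, U p,
  section_on D U X, section_on D U Y &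
  forall q, U q -> [/\ g q (X q) (Y q) = 0, g q (Y q) (Y q) = 1 & g q (X q) (X q) = eps]].
Proof.
have [u [v [uD vD gu gv guv]]] := orthogonal_basis p.
have [dim2 loc] := cs_distribution S.
have [U0 [X0 [Y0 [oU0 U0p CX0 CY0 DE]]]] := loc p.
have SX0 : section_on D U0 X0.
  by split=> // q U0q; rewrite DE// memv_span// mem_head.
have SY0 : section_on D U0 Y0.
  by split=> // q U0q; rewrite DE// memv_span// inE mem_head orbT.
have ext w : w \in D p -> exists2 X, section_on D U0 X & X p = w.
  rewrite (DE _ U0p) span_cons span_seq1 => /memv_addP[w1 /vlineP[a ->]].
  move=> [w2 /vlineP[b ->] ->].
  exists (fun q => a *: X0 q + b *: Y0 q); last by [].
  have Ca : smooth_fun U0 ((fun=> a) : M -> R^o) by exact: smooth_fun_cst.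
  have Cb : smooth_fun U0 ((fun=> b) : M -> R^o) by exact: smooth_fun_cst.
  exact: (section_lin oU0 Ca SX0 (section_Z oU0 Cb SY0)).
have [X1 SX1 X1p] := ext _ uD; have [Y1 SY1 Y1p] := ext _ vD.
pose gXX : M -> R^o := fun q => eps * g q (X1 q) (X1 q).
have CgXX : smooth_fun U0 gXX.
  apply: smooth_funM => //; first exact: smooth_fun_cst.
  exact: cs_smooth.
pose U1 := U0 `&` [set q | 0 < gXX q].
have oU1 : open U1 by exact: open_pos.
have U10 : U1 `<=` U0 by move=> ? [].
have U1p : U1 p by split=> //; rewrite /gXX /= X1p.
have {}SX1 := section_sub U10 SX1; have {}SY1 := section_sub U10 SY1.
have {}CgXX := smooth_fun_sub U10 CgXX.
have gXX0 q : U1 q -> 0 < gXX q by case.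
have CgXY : smooth_fun U1 ((fun q => g q (Y1 q) (X1 q)) : M -> R^o).
  exact: cs_smooth.
(* Minus the projection coefficient of [Y1] on [X1]: the factor [eps] cancels the one inside
   [gXX]. *)
pose c : M -> R^o := fun q => - (eps * g q (Y1 q) (X1 q) * (gXX q)^-1).
have Cc : smooth_fun U1 c.
  apply: smooth_funN => //; apply: smooth_funM => //.
    by apply: smooth_funM => //; exact: smooth_fun_cst.
  by apply: smooth_funV => // q /gXX0; rewrite lt0r => /andP[].
pose Y2 q := c q *: X1 q + Y1 q.
have SY2 : section_on D U1 Y2 by exact: section_lin.
(* At [p] the basis is already orthogonal, so [c] vanishes there and the sign known for [v] carries
   over to [Y2]. *)
have Y2p : Y2 p = v.
  by rewrite /Y2 /c X1p Y1p cs_sym// guv mulr0 mul0r oppr0 scale0r add0r.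
have gX2Y q : U1 q -> g q (X1 q) (Y2 q) = 0.
  move=> U1q; have DX := SX1.2 _ U1q; have DY := SY1.2 _ U1q.
  rewrite /Y2 cs_linearr// /c [g q (X1 q) (Y1 q)]cs_sym//.
  have := gXX0 _ U1q; rewrite /gXX; set a := g q (X1 q) _ => a0.
  have a1 : a != 0 by apply: contraTneq a0 => ->; rewrite mulr0 ltxx.
  by field; rewrite a1 frame_sign_neq0.
pose gYY : M -> R^o := fun q => g q (Y2 q) (Y2 q).
have CgYY : smooth_fun U1 gYY by exact: cs_smooth.
pose U2 := U1 `&` [set q | 0 < gYY q].
have oU2 : open U2 by exact: open_pos.
have U21 : U2 `<=` U1 by move=> ? [].
have {}SX1 := section_sub U21 SX1; have {}SY2 := section_sub U21 SY2.
have {}CgXX := smooth_fun_sub U21 CgXX; have {}CgYY := smooth_fun_sub U21 CgYY.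
have CN (f : M -> R^o) : smooth_fun U2 f -> (forall q, U2 q -> 0 < f q) ->
    smooth_fun U2 ((fun q => (Num.sqrt (f q))^-1) : M -> R^o).
  move=> Cf f0; apply: smooth_funV => //; last exact: smooth_fun_sqrt.
  by move=> q /f0; rewrite -sqrtr_gt0 lt0r => /andP[].
exists U2, (fun q => (Num.sqrt (gXX q))^-1 *: X1 q), (fun q => (Num.sqrt (gYY q))^-1 *: Y2 q).
split; first exact: oU2.
- by split; [exact: U1p|rewrite /= /gYY Y2p].
- by apply: section_Z => //; apply: CN => // q [/gXX0].
- by apply: section_Z => //; apply: CN => // q [].
move=> q U2q; have [U1q gY0] := U2q.
have DX := SX1.2 _ U2q; have DY := SY2.2 _ U2q.
have sq (r : R) : 0 < r -> (Num.sqrt r)^-1 * (Num.sqrt r)^-1 = r^-1.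
  by move=> r0; rewrite -invfM -expr2 sqr_sqrtr// ltW.
rewrite !cs_gZl ?memvZ// !cs_gZr// gX2Y// !mulr0; split=> //.
  by rewrite mulrA sq// mulVf// gt_eqF.
have gX := gXX0 _ U1q.
rewrite mulrA sq// {1}/gXX invfM -mulrA mulVf ?mulr1.
  by rewrite -[LHS]mulr1 -frame_sign2 mulKf// frame_sign_neq0.
by apply: contraTneq gX => e; rewrite /gXX e mulr0 ltxx.
Qed.

End ContactFrames.

(** * Existence of the Reeb field and of adapted frames *)

Section ReebField.
Variables (R : realType) (M : manifold3 R) (S : contact_structure M).
Local Notation E := 'rV[R]_3.
Implicit Types (U V : set M) (X Y Z : M -> E) (p q : M).

Local Notation eps := (frame_sign S).
Local Notation g := (@cs_g R M S).
Local Notation D := (@cs_D R M S).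

Definition frame_of (X0 X1 X2 : M -> E) (i : 'I_3) : M -> E :=
  if i == 0 then X0 else if i == 1 then X1 else X2.

Lemma ord3_ind (P : 'I_3 -> Prop) : P 0 -> P 1 -> P 2 -> forall i, P i.
Proof.
move=> P0 P1 P2; case=> [[|[|[|n]]] ni] //.
- by rewrite (_ : Ordinal ni = 0)//; exact: val_inj.
- by rewrite (_ : Ordinal ni = 1)//; exact: val_inj.
- by rewrite (_ : Ordinal ni = 2)//; exact: val_inj.
Qed.

Lemma sum3 (V : nmodType) (F : 'I_3 -> V) : \sum_(i < 3) F i = F 0 + F 1 + F 2.
Proof.
rewrite !big_ord_recl big_ord0 addr0 addrA.
by congr (_ + F _ + F _); exact: val_inj.
Qed.

Lemma mul_frame_mx (v : E) (X : 'I_3 -> M -> E) p :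
  v *m frame_mx X p = v 0 0 *: X 0 p + v 0 1 *: X 1 p + v 0 2 *: X 2 p.
Proof. by apply/rowP => j; rewrite !mxE sum3 !mxE. Qed.

Lemma unitmx_ker n (A : 'M[R]_n) :
  (forall v : 'rV_n, v *m A = 0 -> v = 0) -> A \in unitmx.
Proof. by move=> kA; rewrite -row_free_unit; exact: inj_row_free. Qed.

(* The contact condition, evaluated on a frame completed by a coordinate field
   transverse to the distribution. *)
Lemma contact_form_bracket U (a : M -> 'cV[R]_3) X1 X2 q : open U -> U q ->
  smooth_form U a ->
  (forall q v, U q -> (v \in D q) = ((v *m a q) 0 0 == 0)) ->
  (forall V (X : 'I_3 -> M -> 'rV[R]_3), open V -> V `<=` U ->
        (forall i, smooth_vfield V (X i)) ->
        forall q, V q -> frame_mx X q \in unitmx ->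
          wedge_dform a (X 0) (X 1) (X 2) q != 0) ->
  section_on D U X1 -> section_on D U X2 ->
  (forall q, U q -> [/\ g q (X1 q) (X2 q) = 0, g q (X2 q) (X2 q) = 1 & g q (X1 q) (X1 q) = eps]) ->
  form_eval a (lbracket X1 X2) q != 0.
Proof.
move=> oU Uq Ca aD wedge SX1 SX2 ortho; have [CX1 DX1] := SX1; have [CX2 DX2] := SX2.
have [dim2 _] := cs_distribution S.
have [i iD] : exists i, delta_mx 0 i \notin D q.
  apply: contrapT => /forallNP H.
  have sub : (fullv <= D q)%VS.
    apply/subvP => v _; rewrite (row_sum_delta v); apply: memv_suml => i _.
    by rewrite memvZ//; have /negP := H i; rewrite negbK.
  by have := dimvS sub; rewrite dim2 dimvf.
pose Z := coord_vfield q i.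
pose V := U `&` chart_src (chart_at q).
have oV : open V by exact: open_setI_chart.
have Vq : V q by split=> //; exact: chart_at_src.
have VU : V `<=` U by move=> ? [].
have CZ : smooth_vfield V Z by apply: smooth_vfield_sub (smooth_coord_vfield q i) => ? [].
have a0 X p : U p -> X p \in D p -> form_eval a X p = 0.
  by move=> Up; rewrite aD// => /eqP.
have aZ : form_eval a Z q != 0.
  by move: iD; rewrite aD// -(coord_vfield_at q i).
have CX i' : smooth_vfield V (frame_of Z X1 X2 i').
  elim/ord3_ind: i'; first exact: CZ.
    exact: (smooth_vfield_sub VU CX1).
  exact: (smooth_vfield_sub VU CX2).
have [g12 g22 g11] := ortho _ Uq.
have unit : frame_mx (frame_of Z X1 X2) q \in unitmx.
  apply: unitmx_ker => v; rewrite mul_frame_mx /frame_of /= => vX.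
  have v0 : v 0 0 = 0.
    have : form_eval a (fun p => v 0 0 *: Z p + (v 0 1 *: X1 p + v 0 2 *: X2 p)) q = 0.
      by rewrite /form_eval addrA vX mul0mx mxE.
    rewrite (form_eval_lin a (fun=> v 0 0)) [X in _ + X]a0//.
      by move=> /eqP; rewrite addr0 mulf_eq0 (negbTE aZ) orbF => /eqP.
    by rewrite memvD ?memvZ ?DX1 ?DX2.
  rewrite v0 scale0r add0r in vX.
  have D1 := DX1 _ Uq; have D2 := DX2 _ Uq.
  have v1 : v 0 1 = 0.
    have : g q (v 0 1 *: X1 q + v 0 2 *: X2 q) (X1 q) = 0 by rewrite vX cs_g0l.
    rewrite cs_linear ?memvZ// cs_gZl// g11 [g q (X2 q) _]cs_sym// g12 mulr0 addr0.
    by move=> /eqP; rewrite mulf_eq0 (negbTE (frame_sign_neq0 S)) orbF => /eqP.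
  have v2 : v 0 2 = 0.
    have : g q (v 0 1 *: X1 q + v 0 2 *: X2 q) (X2 q) = 0 by rewrite vX cs_g0l.
    by rewrite cs_linear ?memvZ// cs_gZl// g22 g12 mulr0 add0r mulr1.
  by apply/rowP => j; rewrite mxE; elim/ord3_ind: j.
have := wedge _ _ oV VU CX _ Vq unit; rewrite /frame_of /= /wedge_dform /dform.
have a1 := a0 X1 _ Uq (DX1 _ Uq); have a2 := a0 X2 _ Uq (DX2 _ Uq).
(* [a] vanishes on [X1] and [X2] throughout [U], so the derivatives of these values vanish too, and
   the wedge reduces to minus the product of a(Z) and a([X1, X2]). *)
have aX0 X Y : section_on D U Y -> vderiv X (form_eval a Y : M -> R^o) q = 0.
  move=> [_ DY]; rewrite vderivE -(lderiv_cst X (0 : R^o) q).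
  by apply: (lderiv_eq oU Uq) => // p Up; rewrite a0// DY.
have d12 := aX0 X1 X2 SX2; have d21 := aX0 X2 X1 SX1.
rewrite bracketE.
move: (form_eval a X1 q) (form_eval a X2 q) a1 a2 => _ _ -> ->.
rewrite d12 d21.
have aux (z w b c : R) : z * (0 - 0 - w) + 0 * b + 0 * c != 0 -> w != 0.
  by apply: contra_neq => ->; ring.
exact: aux.
Qed.

(** The condition on [X1, X2] forces X0 to be that bracket up to a section of the distribution. The
    other two conditions become linear equations for the two remaining coefficients: derivatives of
    the coefficients only multiply X1 or X2, which [a] kills, and the pivot a([X1, X2]) does not
    vanish. *)
Lemma adapted_frame_exists p : exists U (X : 'I_3 -> M -> E), adapted_frame S U X /\ U p.
Proof.
have [Ua [a [oUa Uap Ca aD wedge]]] := cs_contact S p.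
have [U1 [X1 [X2 [oU1 U1p SX1 SX2 ortho]]]] := orthonormal_frame S p.
pose U := Ua `&` U1.
have oU : open U by exact: openI.
have UUa : U `<=` Ua by move=> ? [].
have UU1 : U `<=` U1 by move=> ? [].
have {}SX1 := section_sub UU1 SX1; have {}SX2 := section_sub UU1 SX2.
have {}aD q v (Uq : U q) := aD q v (UUa q Uq).
have {}ortho q (Uq : U q) := ortho q (UU1 q Uq).
have {}Ca : smooth_form U a.
  by move=> V X oV VU; apply: Ca oV _ => q /VU /UUa.
have {}wedge V (X : 'I_3 -> M -> E) (oV : open V) (VU : V `<=` U) :=
  wedge V X oV (subset_trans VU UUa).
have [CX1 DX1] := SX1; have [CX2 DX2] := SX2.
pose W := lbracket X1 X2.
have CW : smooth_vfield U W by exact: smooth_lbracket.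
have aW0 q : U q -> form_eval a W q != 0.
  by move=> Uq; exact: (contact_form_bracket oU Uq Ca).
have CaW := Ca _ _ oU (@subset_refl _ U) CW.
have CWX X : smooth_vfield U X ->
    smooth_fun U ((fun q => form_eval a (lbracket W X) q * (form_eval a W q)^-1) : M -> R^o).
  move=> CX; apply: smooth_funM => //; last exact: smooth_funV.
  exact: (Ca _ _ oU (@subset_refl _ U) (smooth_lbracket oU CW CX)).
pose A : M -> R^o := fun q => form_eval a (lbracket W X1) q * (form_eval a W q)^-1.
pose B : M -> R^o := fun q => - (form_eval a (lbracket W X2) q * (form_eval a W q)^-1).
have CA : smooth_fun U A by exact: CWX.
have CB : smooth_fun U B by apply: smooth_funN => //; exact: CWX.
(* The coefficients [A] and [B] are the ones for which the contact form
   vanishes on [[X0, X1]] and [[X0, X2]]. *)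
pose Y q := B q *: X1 q + W q.
have CY : smooth_vfield U Y by exact: smooth_vfield_lin.
pose X0 q := A q *: X2 q + Y q.
have CX0 : smooth_vfield U X0 by exact: smooth_vfield_lin.
have aX1 q : U q -> form_eval a X1 q = 0.
  by move=> Uq; apply/eqP; rewrite -aD// DX1.
have aX2 q : U q -> form_eval a X2 q = 0.
  by move=> Uq; apply/eqP; rewrite -aD// DX2.
exists U, (frame_of X0 X1 X2); split; last by [].
have form_addl (u v : E) q : ((u + v) *m a q) 0 0 = (u *m a q) 0 0 + (v *m a q) 0 0.
  by rewrite mulmxDl mxE.
have form_opp (u : E) q : ((- u) *m a q) 0 0 = - (u *m a q) 0 0.
  by rewrite mulNmx mxE.
have form_Z (u : E) c q : ((c *: u) *m a q) 0 0 = c * (u *m a q) 0 0.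
  by rewrite -scalemxAl mxE.
have form_0 q : ((0 : E) *m a q) 0 0 = 0 by rewrite mul0mx mxE.
split; [exact: oU|split; [exact: SX1|exact: SX2]|exact: CX0|exact: ortho|].
rewrite /frame_of /=; move=> q Uq; rewrite !bracketE; have aW := aW0 _ Uq.
have b1 := aX1 _ Uq; have b2 := aX2 _ Uq.
rewrite /form_eval in aW b1 b2.
split.
- rewrite aD// /X0 (lbracket_linl oU Uq)// (lbracket_linl oU Uq)//.
  rewrite lbracketxx [lbracket X2 X1 q]lbracketC.
  rewrite !form_addl !form_opp !form_Z form_opp b1 b2 form_0 -/W /A /form_eval.
  by apply/eqP; field.
- rewrite aD// /X0 (lbracket_linl oU Uq)// (lbracket_linl oU Uq)//.
  rewrite lbracketxx.
  rewrite !form_addl !form_opp !form_Z b1 b2 form_0 -/W /B /form_eval.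
  by apply/eqP; field.
- rewrite -/W /X0 /Y aD// !(form_addl, form_opp, form_Z) b1 b2.
  by apply/eqP; ring.
Qed.

End ReebField.

(** * Brackets and tensors on combinations of three fields *)

(** Puts the zero field into the shape treated by the linearity lemmas; their instance then reads t
    = t + t, which gives t = 0. *)
Lemma scale_add0 (R : realType) (T : Type) (V : lmodType R) :
  (fun=> 0) = (fun _ : T => 1 *: (0 : V) + 0).
Proof. by apply/funext => t; rewrite scaler0 addr0. Qed.

Section LieSums.
Variables (R : realType) (M : manifold3 R).
Local Notation E := 'rV[R]_3.
Implicit Types (U V : set M) (X Y Z : M -> E) (p q : M).

Lemma lderivMr U X (a : M -> R^o) (k : R) p : U p -> smooth_fun U a ->
  lderiv X ((fun q => a q * k) : M -> R^o) p = lderiv X a p * k.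
Proof.
move=> Up Ca.
have Ck : smooth_fun U ((fun=> k) : M -> R^o) by exact: smooth_fun_cst.
by rewrite (lderivM X Up Ca Ck) lderiv_cst mulr0 add0r.
Qed.

Lemma lbracket_sumr U (a : 'I_3 -> M -> R^o) X (Y : 'I_3 -> M -> E) p :
  open U -> U p -> (forall i, smooth_fun U (a i)) -> smooth_vfield U X ->
  (forall i, smooth_vfield U (Y i)) ->
  lbracket X (fun q => \sum_(i < 3) a i q *: Y i q) p =
  \sum_(i < 3) (a i p *: lbracket X (Y i) p + lderiv X (a i) p *: Y i p).
Proof.
move=> oU Up Ca CX CY; have C0 := smooth_vfield0 oU.
have b0 : lbracket X (fun=> 0) p = 0.
  have C1 : smooth_fun U ((fun=> 1) : M -> R^o) by exact: smooth_fun_cst.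
  have : lbracket X (fun=> 0) p = 1 *: lbracket X (fun=> 0) p +
      lderiv X ((fun=> 1) : M -> R^o) p *: 0 + lbracket X (fun=> 0) p.
    by rewrite {1}scale_add0; exact: (lbracket_linr oU Up C1 CX C0 C0).
  by rewrite scale1r scaler0 addr0 => /esym/(canRL (addrK _)); rewrite subrr.
rewrite (_ : (fun q => \sum_(i < 3) a i q *: Y i q) =
    (fun q => a 0 q *: Y 0 q + (a 1 q *: Y 1 q + (a 2 q *: Y 2 q + 0)))); last first.
  by apply/funext => q; rewrite sum3 addr0 addrA.
have C2' := smooth_vfield_lin oU (Ca 2) (CY 2) C0.
have C1' := smooth_vfield_lin oU (Ca 1) (CY 1) C2'.
rewrite (lbracket_linr oU Up (Ca 0) CX (CY 0) C1') (lbracket_linr oU Up (Ca 1) CX (CY 1) C2').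
by rewrite (lbracket_linr oU Up (Ca 2) CX (CY 2) C0) b0 sum3 addr0 addrA.
Qed.

(** Stated for an abstract operator [T] so as to serve the first argument of a connection and each
    of the three arguments of the curvature. *)
Lemma tensor_sum U p (T : (M -> E) -> E) (a : 'I_3 -> M -> R^o) (Y : 'I_3 -> M -> E) :
  open U ->
  (forall (b : M -> R^o) X Z, smooth_fun U b -> smooth_vfield U X -> smooth_vfield U Z ->
    T (fun q => b q *: X q + Z q) = b p *: T X + T Z) ->
  (forall i, smooth_fun U (a i)) -> (forall i, smooth_vfield U (Y i)) ->
  T (fun q => \sum_(i < 3) a i q *: Y i q) = \sum_(i < 3) a i p *: T (Y i).
Proof.
move=> oU TL Ca CY; have C0 := smooth_vfield0 oU.
have T0 : T (fun=> 0) = 0.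
  have C1 : smooth_fun U ((fun=> 1) : M -> R^o) by exact: smooth_fun_cst.
  have : T (fun=> 0) = 1 *: T (fun=> 0) + T (fun=> 0).
    by rewrite {1}scale_add0; exact: (TL _ _ _ C1 C0 C0).
  by rewrite scale1r => /esym/(canRL (addrK _)); rewrite subrr.
rewrite (_ : (fun q => \sum_(i < 3) a i q *: Y i q) =
    (fun q => a 0 q *: Y 0 q + (a 1 q *: Y 1 q + (a 2 q *: Y 2 q + 0)))); last first.
  by apply/funext => q; rewrite sum3 addr0 addrA.
have C2' := smooth_vfield_lin oU (Ca 2) (CY 2) C0.
have C1' := smooth_vfield_lin oU (Ca 1) (CY 1) C2'.
rewrite (TL _ _ _ (Ca 0) (CY 0) C1') (TL _ _ _ (Ca 1) (CY 1) C2').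
by rewrite (TL _ _ _ (Ca 2) (CY 2) C0) T0 sum3 addr0 addrA.
Qed.

End LieSums.

(** * Locality of connections and tensoriality of curvature *)

Section Connection.
Variables (R : realType) (M : manifold3 R).
Local Notation E := 'rV[R]_3.
Implicit Types (U V : set M) (X Y Z : M -> E) (p q : M).

Variable nabla : (M -> E) -> (M -> E) -> M -> E.
Hypothesis nabla_connection : is_connection nabla.

Lemma smooth_nabla U X Y : open U -> smooth_vfield U X -> smooth_vfield U Y ->
  smooth_vfield U (nabla X Y).
Proof.
move=> oU CX CY.
have C0 : smooth_fun U ((fun=> 0) : M -> R^o) by exact: smooth_fun_cst.
exact: (nabla_connection oU C0 CX CX CY CY).1.
Qed.

Lemma nabla_linl U (a : M -> R^o) X X' Y p : open U -> U p -> smooth_fun U a ->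
  smooth_vfield U X -> smooth_vfield U X' -> smooth_vfield U Y ->
  nabla (fun q => a q *: X q + X' q) Y p = a p *: nabla X Y p + nabla X' Y p.
Proof.
move=> oU Up Ca CX CX' CY.
by have [_ /(_ p Up)[]] := nabla_connection oU Ca CX CX' CY CY.
Qed.

Lemma nabla_linr U (a : M -> R^o) X Y Y' p : open U -> U p -> smooth_fun U a ->
  smooth_vfield U X -> smooth_vfield U Y -> smooth_vfield U Y' ->
  nabla X (fun q => a q *: Y q + Y' q) p =
  a p *: nabla X Y p + lderiv X a p *: Y p + nabla X Y' p.
Proof.
move=> oU Up Ca CX CY CY'; have CaY := smooth_vfieldZ oU Ca CY.
have [_ /(_ p Up)[_ -> _]] := nabla_connection oU Ca CX CX CaY CY'.
have [_ /(_ p Up)[_ _ ->]] := nabla_connection oU Ca CX CX CY CY'.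
by rewrite vderivE.
Qed.

(* A connection is local: multiplying the fields by the indicator function of
   [U], which is smooth on [U], makes them equal as total functions. *)
Lemma nabla_eq U X X' Y Y' p : open U -> U p ->
  smooth_vfield U X -> smooth_vfield U Y ->
  (forall q, U q -> X q = X' q) -> (forall q, U q -> Y q = Y' q) ->
  nabla X Y p = nabla X' Y' p.
Proof.
move=> oU Up CX CY XX YY.
have CX' := smooth_vfield_eq oU XX CX; have CY' := smooth_vfield_eq oU YY CY.
pose f : M -> R^o := fun q => (q \in U)%:R.
have fU q : U q -> f q = 1 by move=> Uq; rewrite /f mem_set.
have Cf : smooth_fun U f.
  have C1 : smooth_fun U ((fun=> 1) : M -> R^o) by exact: smooth_fun_cst.
  by apply: smooth_fun_eq oU _ C1 => q Uq; rewrite fU.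
have C0 := smooth_vfield0 oU.
have cut Z Z' : (forall q, U q -> Z q = Z' q) ->
    (fun q => f q *: Z q + 0) = (fun q => f q *: Z' q + 0).
  move=> ZZ; apply/funext => q; rewrite /f.
  by case: (boolP (q \in U)) => [/set_mem/ZZ ->|_] //; rewrite !scale0r.
(* The indicator function is constant near [p], so the Leibniz term disappears. *)
have lf Z : lderiv Z f p = 0.
  rewrite -(lderiv_cst Z (1 : R^o) p); exact: (lderiv_eq oU Up).
have cutr Z Z' T : smooth_vfield U T -> smooth_vfield U Z -> smooth_vfield U Z' ->
    (forall q, U q -> Z q = Z' q) -> nabla T Z p = nabla T Z' p.
  move=> CT CZ CZ' /cut e.
  have := congr1 (fun Z => nabla T Z p) e.
  rewrite (nabla_linr oU Up Cf CT CZ C0) (nabla_linr oU Up Cf CT CZ' C0).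
  by rewrite lf fU// !scale1r !scale0r !addr0 => /addIr.
rewrite (cutr _ _ _ CX CY CY' YY).
have := congr1 (fun Z => nabla Z Y' p) (cut _ _ XX).
rewrite (nabla_linl oU Up Cf CX C0 CY') (nabla_linl oU Up Cf CX' C0 CY').
by rewrite fU// !scale1r => /addIr.
Qed.


Lemma nabla0r U X p : open U -> U p -> smooth_vfield U X -> nabla X (fun=> 0) p = 0.
Proof.
move=> oU Up CX; have C0 := smooth_vfield0 oU.
have C1 : smooth_fun U ((fun=> 1) : M -> R^o) by exact: smooth_fun_cst.
have : nabla X (fun=> 0) p = 1 *: nabla X (fun=> 0) p +
    lderiv X ((fun=> 1) : M -> R^o) p *: 0 + nabla X (fun=> 0) p.
  by rewrite {1}scale_add0; exact: (nabla_linr oU Up C1 CX C0 C0).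
by rewrite scale1r scaler0 addr0 => /esym/(canRL (addrK _)); rewrite subrr.
Qed.

Lemma nabla_sumr U (a : 'I_3 -> M -> R^o) X (Y : 'I_3 -> M -> E) p :
  open U -> U p -> (forall i, smooth_fun U (a i)) -> smooth_vfield U X ->
  (forall i, smooth_vfield U (Y i)) ->
  nabla X (fun q => \sum_(i < 3) a i q *: Y i q) p =
  \sum_(i < 3) (a i p *: nabla X (Y i) p + lderiv X (a i) p *: Y i p).
Proof.
move=> oU Up Ca CX CY.
rewrite (_ : (fun q => \sum_(i < 3) a i q *: Y i q) =
    (fun q => a 0 q *: Y 0 q + (a 1 q *: Y 1 q + (a 2 q *: Y 2 q + 0)))); last first.
  by apply/funext => q; rewrite sum3 addr0 addrA.
have C0 := smooth_vfield0 oU.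
have C2' := smooth_vfield_lin oU (Ca 2) (CY 2) C0.
have C1' := smooth_vfield_lin oU (Ca 1) (CY 1) C2'.
rewrite (nabla_linr oU Up (Ca 0) CX (CY 0) C1') (nabla_linr oU Up (Ca 1) CX (CY 1) C2').
rewrite (nabla_linr oU Up (Ca 2) CX (CY 2) C0) (nabla0r oU Up CX).
by rewrite sum3 addr0 addrA.
Qed.

Lemma nabla_suml U (a : 'I_3 -> M -> R^o) (X : 'I_3 -> M -> E) Y p :
  open U -> U p -> (forall i, smooth_fun U (a i)) ->
  (forall i, smooth_vfield U (X i)) -> smooth_vfield U Y ->
  nabla (fun q => \sum_(i < 3) a i q *: X i q) Y p =
  \sum_(i < 3) a i p *: nabla (X i) Y p.
Proof.
move=> oU Up Ca CX CY.
apply: (tensor_sum (T := fun X => nabla X Y p) oU _ Ca CX) => b X1 X2 Cb C1 C2.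
exact: (nabla_linl oU Up Cb C1 C2 CY).
Qed.

(** The derivative of [a] along [Y] appears once through the Leibniz rule for [nabla Y] and once
    through the bracket, and the two contributions cancel. *)
Lemma curvature_linl U (a : M -> R^o) X X' Y Z p : open U -> U p -> smooth_fun U a ->
  smooth_vfield U X -> smooth_vfield U X' -> smooth_vfield U Y -> smooth_vfield U Z ->
  curvature nabla (fun q => a q *: X q + X' q) Y Z p =
  a p *: curvature nabla X Y Z p + curvature nabla X' Y Z p.
Proof.
move=> oU Up Ca CX CX' CY CZ; rewrite /curvature !bracketE.
have CYZ := smooth_nabla oU CY CZ; have CXZ := smooth_nabla oU CX CZ.
have CX'Z := smooth_nabla oU CX' CZ.
have CaX := smooth_vfield_lin oU Ca CX CX'.
have Cda : smooth_fun U (fun q => - lderiv Y a q).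
  exact: (smooth_funN oU (smooth_lderiv oU CY Ca)).
have CXY := smooth_lbracket oU CX CY; have CX'Y := smooth_lbracket oU CX' CY.
have CdX := smooth_vfield_lin oU Cda CX CX'Y.
have e1 : nabla Y (nabla (fun q => a q *: X q + X' q) Z) p =
    nabla Y (fun q => a q *: nabla X Z q + nabla X' Z q) p.
  apply: (nabla_eq oU Up CY (smooth_nabla oU CaX CZ)); first by [].
  by move=> q Uq; exact: (nabla_linl oU Uq Ca CX CX' CZ).
have e2 : nabla (lbracket (fun q => a q *: X q + X' q) Y) Z p =
    nabla (fun q => a q *: lbracket X Y q + ((- lderiv Y a q) *: X q + lbracket X' Y q)) Z p.
  apply: (nabla_eq oU Up (smooth_lbracket oU CaX CY) CZ); last by [].
  by move=> q Uq; rewrite (lbracket_linl oU Uq Ca CY CX CX') scaleNr addrA.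
rewrite (nabla_linl oU Up Ca CX CX' CYZ) e1 e2 (nabla_linr oU Up Ca CY CXZ CX'Z).
rewrite (nabla_linl oU Up Ca CXY CdX CZ) (nabla_linl oU Up Cda CX CX'Y CZ).
by apply/rowP => i; rewrite !mxE; ring.
Qed.

Lemma curvature_anti U X Y Z p : open U -> U p ->
  smooth_vfield U X -> smooth_vfield U Y -> smooth_vfield U Z ->
  curvature nabla X Y Z p = - curvature nabla Y X Z p.
Proof.
move=> oU Up CX CY CZ; rewrite /curvature !bracketE.
have Cm : smooth_fun U ((fun=> -1) : M -> R^o) by exact: smooth_fun_cst.
have C0 := smooth_vfield0 oU; have CYX := smooth_lbracket oU CY CX.
have := nabla_linl oU Up Cm C0 C0 CZ.
rewrite (_ : (fun q => _) = (fun=> 0)); last first.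
  by apply/funext => q; rewrite scaler0 addr0.
rewrite scaleN1r addNr => n0.
rewrite (_ : lbracket X Y = (fun q => -1 *: lbracket Y X q + 0)); last first.
  by apply/funext => q; rewrite lbracketC scaleN1r addr0.
rewrite (nabla_linl oU Up Cm CYX C0 CZ) n0 addr0 scaleN1r.
by apply/rowP => i; rewrite !mxE; ring.
Qed.

(** The mixed first-order terms are symmetric in [X] and [Y]; the second derivatives of [a] cancel
    against its derivative along the bracket, since brackets act as commutators. *)
Lemma curvature_linr U (a : M -> R^o) X Y Z Z' p : open U -> U p -> smooth_fun U a ->
  smooth_vfield U X -> smooth_vfield U Y -> smooth_vfield U Z -> smooth_vfield U Z' ->
  curvature nabla X Y (fun q => a q *: Z q + Z' q) p =
  a p *: curvature nabla X Y Z p + curvature nabla X Y Z' p.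
Proof.
move=> oU Up Ca CX CY CZ CZ'; rewrite /curvature !bracketE.
have CaZ := smooth_vfield_lin oU Ca CZ CZ'.
have second X' Y' : smooth_vfield U X' -> smooth_vfield U Y' ->
    nabla X' (nabla Y' (fun q => a q *: Z q + Z' q)) p =
    a p *: nabla X' (nabla Y' Z) p + lderiv X' a p *: nabla Y' Z p +
    (lderiv Y' a p *: nabla X' Z p + lderiv X' (lderiv Y' a) p *: Z p +
     nabla X' (nabla Y' Z') p).
  move=> CX' CY'; have CY'Z := smooth_nabla oU CY' CZ.
  have CY'Z' := smooth_nabla oU CY' CZ'; have CY'a := smooth_lderiv oU CY' Ca.
  have e : nabla X' (nabla Y' (fun q => a q *: Z q + Z' q)) p =
      nabla X' (fun q => a q *: nabla Y' Z q + (lderiv Y' a q *: Z q + nabla Y' Z' q)) p.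
    apply: (nabla_eq oU Up CX' (smooth_nabla oU CY' CaZ)); first by [].
    by move=> q Uq; rewrite (nabla_linr oU Uq Ca CY' CZ CZ') addrA.
  rewrite e (nabla_linr oU Up Ca CX' CY'Z (smooth_vfield_lin oU CY'a CZ CY'Z')).
  by rewrite (nabla_linr oU Up CY'a CX' CZ CY'Z').
rewrite (second _ _ CX CY) (second _ _ CY CX).
rewrite (nabla_linr oU Up Ca (smooth_lbracket oU CX CY) CZ CZ').
rewrite (lderiv_lbracket oU Up CX CY Ca).
by apply/rowP => i; rewrite !mxE; ring.
Qed.

Lemma curvature_eq U X X' Y Y' Z Z' p : open U -> U p ->
  smooth_vfield U X -> smooth_vfield U Y -> smooth_vfield U Z ->
  (forall q, U q -> X q = X' q) -> (forall q, U q -> Y q = Y' q) ->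
  (forall q, U q -> Z q = Z' q) ->
  curvature nabla X Y Z p = curvature nabla X' Y' Z' p.
Proof.
move=> oU Up CX CY CZ XX YY ZZ; rewrite /curvature !bracketE.
have CYZ := smooth_nabla oU CY CZ; have CXZ := smooth_nabla oU CX CZ.
have CXY := smooth_lbracket oU CX CY.
congr (_ - _ - _).
- by apply: (nabla_eq oU Up CX CYZ XX) => q Uq; exact: (nabla_eq oU Uq CY CZ).
- by apply: (nabla_eq oU Up CY CXZ YY) => q Uq; exact: (nabla_eq oU Uq CX CZ).
- by apply: (nabla_eq oU Up CXY CZ) => // q Uq; exact: (lbracket_eq oU Uq).
Qed.

End Connection.

(** * The curvature computation as pure algebra in the structural functions *)

Section FrameAlgebra.
Variable R : realType.
Implicit Types (eps k : R) (c : 'I_3 -> 'I_3 -> 'I_3 -> R).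

Definition frame_norm eps k (i : 'I_3) : R :=
  if i == 0 then k else if i == 1 then eps else 1.

(* The coefficients of the Levi-Civita connection in an orthogonal frame with
   constant norms [h] and structural functions [c]. *)
Definition koszul_coef (h : 'I_3 -> R) c (i j l : 'I_3) : R :=
  (c i j l * h l - c j l i * h i + c l i j * h j) / (2 * h l).

(* [d n i j l] stands for the derivative of [c i j l] along the [n]-th field *)
Lemma frame_curvature_coef eps k c (d : 'I_3 -> 'I_3 -> 'I_3 -> 'I_3 -> R) :
  eps = 1 \/ eps = -1 -> k != 0 ->
  (forall i j l, c j i l = - c i j l) ->
  (forall n i j l, d n j i l = - d n i j l) ->
  c 0 1 0 = 0 -> c 0 1 1 = 0 -> c 0 2 0 = 0 -> c 0 2 2 = 0 ->
  c 0 2 1 = - eps * c 0 1 2 -> c 1 2 0 = 1 ->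
  (forall n, d n 0 1 0 = 0) -> (forall n, d n 0 1 1 = 0) ->
  (forall n, d n 0 2 0 = 0) -> (forall n, d n 0 2 2 = 0) ->
  (forall n, d n 0 2 1 = - eps * d n 0 1 2) -> (forall n, d n 1 2 0 = 0) ->
  k = d 1 1 2 2 - eps * d 2 1 2 1 - eps * c 1 2 1 ^+ 2 - c 1 2 2 ^+ 2 + c 0 1 2 ->
  (forall m, d 0 1 2 m + d 1 2 0 m + d 2 0 1 m +
    \sum_(l < 3) (c 1 2 l * c 0 l m + c 2 0 l * c 1 l m + c 0 1 l * c 2 l m) = 0) ->
  let h := frame_norm eps k in
  let G := koszul_coef h c in
  let dG := fun n => koszul_coef h (d n) in
  forall i j l m,
    dG i j l m - dG j i l m +
    \sum_(n < 3) (G j l n * G i n m - G i l n * G j n m - c i j n * G n l m) =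
    eps * k / 4 * ((j == l)%:R * h j * (i == m)%:R - (i == l)%:R * h i * (j == m)%:R).
Proof.
move=> e1 k0 cA dA c010 c011 c020 c022 c021 c120 d010 d011 d020 d022 d021 d120 kE J.
have cd i l : c i i l = 0.
  have := cA i i l => /eqP; rewrite -addr_eq0 -mulr2n -mulr_natl mulf_eq0 pnatr_eq0 /=.
  by move=> /eqP.
have dd n i l : d n i i l = 0.
  have := dA n i i l => /eqP; rewrite -addr_eq0 -mulr2n -mulr_natl mulf_eq0 pnatr_eq0 /=.
  by move=> /eqP.
have c10 l : c 1 0 l = - c 0 1 l by exact: cA.
have c20 l : c 2 0 l = - c 0 2 l by exact: cA.
have c21 l : c 2 1 l = - c 1 2 l by exact: cA.
have d10 n l : d n 1 0 l = - d n 0 1 l by exact: dA.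
have d20 n l : d n 2 0 l = - d n 0 2 l by exact: dA.
have d21 n l : d n 2 1 l = - d n 1 2 l by exact: dA.
have cE := (cd, c10, c20, c21, c010, c011, c020, c022, c021, c120).
have dE := (dd, d10, d20, d21, d010, d011, d020, d022, d021, d120).
have J1 := J 1; have J2 := J 2; clear J.
(* The components of the Jacobi identity along X1 and X2 determine the derivatives along X0 of
   [c 1 2 1] and [c 1 2 2], and the formula for [kappa] determines the derivative of [c 1 2 2] along
   X1. The remaining derivatives are treated as free unknowns. *)
rewrite !sum3 !(cE, dE) in J1 J2.
have d0a : d 0 1 2 1 = eps * c 0 1 2 * c 1 2 2 - eps * d 1 0 1 2.
  by apply/eqP; rewrite -subr_eq0 -[X in _ == X]J1; apply/eqP; ring.
have d0b : d 0 1 2 2 = - (c 0 1 2 * c 1 2 1) - d 2 0 1 2.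
  by apply/eqP; rewrite -subr_eq0 -[X in _ == X]J2; apply/eqP; ring.
have d1b : d 1 1 2 2 = k + eps * d 2 1 2 1 + eps * c 1 2 1 ^+ 2 + c 1 2 2 ^+ 2 - c 0 1 2.
  by rewrite {1}kE; ring.
clear kE J1 J2 dA => h G dG i j l m.
have hE : ((h 0 = k)%R * (h 1 = eps)%R * (h 2 = 1)%R)%type by [].
have GE x y z : G x y z = (c x y z * h z - c y z x * h x + c z x y * h y) / (2 * h z).
  by [].
have dGE n x y z : dG n x y z =
    (d n x y z * h z - d n y z x * h x + d n z x y * h y) / (2 * h z) by [].
(* The table is a product of equations, so that it acts as a single rewriting rule. Splitting on the
   value of [eps] replaces the relation [eps * eps = 1], which [field] does not know. *)
have GT : (
    (G 0 0 0 = 0)%R * (G 0 0 1 = 0)%R * (G 0 0 2 = 0)%R *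
    (G 0 1 0 = 0)%R * (G 0 1 1 = 0)%R * (G 0 1 2 = c 0 1 2 - k / 2)%R *
    (G 0 2 0 = 0)%R * (G 0 2 1 = eps * (k / 2 - c 0 1 2))%R * (G 0 2 2 = 0)%R *
    (G 1 0 0 = 0)%R * (G 1 0 1 = 0)%R * (G 1 0 2 = - (k / 2))%R *
    (G 1 1 0 = 0)%R * (G 1 1 1 = 0)%R * (G 1 1 2 = - eps * c 1 2 1)%R *
    (G 1 2 0 = 2^-1)%R * (G 1 2 1 = c 1 2 1)%R * (G 1 2 2 = 0)%R *
    (G 2 0 0 = 0)%R * (G 2 0 1 = eps * k / 2)%R * (G 2 0 2 = 0)%R *
    (G 2 1 0 = - 2^-1)%R * (G 2 1 1 = 0)%R * (G 2 1 2 = - c 1 2 2)%R *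
    (G 2 2 0 = 0)%R * (G 2 2 1 = eps * c 1 2 2)%R * (G 2 2 2 = 0)%R)%type.
  do ![split]; rewrite GE !(hE, cE); have [e|e] := e1; rewrite ?e; by field.
(* The terms in [k] of the previous table have no counterpart here: they come from [c 1 2 0], which
   is constant. *)
have dGT n : (
    (dG n 0 0 0 = 0)%R * (dG n 0 0 1 = 0)%R * (dG n 0 0 2 = 0)%R *
    (dG n 0 1 0 = 0)%R * (dG n 0 1 1 = 0)%R * (dG n 0 1 2 = d n 0 1 2)%R *
    (dG n 0 2 0 = 0)%R * (dG n 0 2 1 = - eps * d n 0 1 2)%R * (dG n 0 2 2 = 0)%R *
    (dG n 1 0 0 = 0)%R * (dG n 1 0 1 = 0)%R * (dG n 1 0 2 = 0)%R *
    (dG n 1 1 0 = 0)%R * (dG n 1 1 1 = 0)%R * (dG n 1 1 2 = - eps * d n 1 2 1)%R *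
    (dG n 1 2 0 = 0)%R * (dG n 1 2 1 = d n 1 2 1)%R * (dG n 1 2 2 = 0)%R *
    (dG n 2 0 0 = 0)%R * (dG n 2 0 1 = 0)%R * (dG n 2 0 2 = 0)%R *
    (dG n 2 1 0 = 0)%R * (dG n 2 1 1 = 0)%R * (dG n 2 1 2 = - d n 1 2 2)%R *
    (dG n 2 2 0 = 0)%R * (dG n 2 2 1 = eps * d n 1 2 2)%R * (dG n 2 2 2 = 0)%R)%type.
  do ![split]; rewrite dGE !(hE, dE); have [e|e] := e1; rewrite ?e; by field.
clear GE dGE; clearbody G dG h.
pose lhs i j := dG i j l m - dG j i l m +
  \sum_(n < 3) (G j l n * G i n m - G i l n * G j n m - c i j n * G n l m).
pose rhs i j := eps * k / 4 *
  ((j == l)%:R * h j * (i == m)%:R - (i == l)%:R * h i * (j == m)%:R).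
rewrite -[LHS]/(lhs i j) -[RHS]/(rhs i j).
(* Both sides are antisymmetric in the first two indices, which leaves three pairs to compute. *)
have diag x : lhs x x = rhs x x by rewrite /lhs /rhs sum3 !cd; ring.
have swap x y : lhs x y = rhs x y -> lhs y x = rhs y x.
  move=> e; rewrite (_ : rhs y x = - rhs x y); last by rewrite /rhs; ring.
  by rewrite -e /lhs !sum3 !(cA x y); ring.
have main : [/\ lhs 0 1 = rhs 0 1, lhs 0 2 = rhs 0 2 & lhs 1 2 = rhs 1 2].
  clear diag swap cA; rewrite /lhs /rhs; clear lhs rhs; rewrite !sum3.
  split; elim/ord3_ind: l; elim/ord3_ind: m; rewrite ?GT ?dGT ?cE ?hE /=;
    rewrite ?d0a ?d0b ?d1b; (have [e|e] := e1); rewrite ?e; by field.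
have [m01 m02 m12] := main.
by elim/ord3_ind: i; elim/ord3_ind: j; do ?[exact: diag | exact: swap].
Qed.

End FrameAlgebra.

(** * Bilinear forms, the Koszul formula and linear combinations of a frame *)

Section BilinearForms.
Variable R : realType.
Implicit Types (A : 'M[R]_3) (u v w : 'rV[R]_3).

Lemma mform_linl A (a : R) u v w : mform A (a *: u + v) w = a * mform A u w + mform A v w.
Proof. by rewrite /mform !mulmxDl -!scalemxAl !mxE. Qed.

Lemma mform_sym A u v : A^T = A -> mform A u v = mform A v u.
Proof.
move=> sA; rewrite /mform -[u *m A *m v^T]trmxK [LHS]mxE.
by rewrite !trmx_mul trmxK sA mulmxA.
Qed.

Lemma mform0l A u : mform A 0 u = 0.
Proof. by rewrite /mform !mul0mx mxE. Qed.

Lemma mformZl A (a : R) u v : mform A (a *: u) v = a * mform A u v.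
Proof. by have := mform_linl A a u 0 v; rewrite mform0l !addr0. Qed.

Lemma mformDl A u v w : mform A (u + v) w = mform A u w + mform A v w.
Proof. by have := mform_linl A 1 u v w; rewrite scale1r mul1r. Qed.

Lemma mformZ (a : R) A u v : mform (a *: A) u v = a * mform A u v.
Proof. by rewrite /mform -scalemxAr -scalemxAl mxE. Qed.

Lemma mform_delta A i j : mform A (delta_mx 0 i) (delta_mx 0 j) = A i j.
Proof. by rewrite /mform -rowE trmx_delta -colE !mxE. Qed.

End BilinearForms.

Lemma double_eq0 (R : realType) (x : R) : x + x = 0 -> x = 0.
Proof. by lra. Qed.

(** [N i j l] stands for the product of the covariant derivative of the j-th field along the i-th
    one with the l-th field, and [B] for the same product with brackets. The hypotheses are metric
    compatibility for constant products and vanishing torsion. *)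
Lemma koszul_formula (R : realType) (I : Type) (N B : I -> I -> I -> R) i j l :
  (forall i j l, N i j l + N i l j = 0) ->
  (forall i j l, N i j l - N j i l = B i j l) ->
  2 * N i j l = B i j l - B j l i + B l i j.
Proof.
move=> A T; have := A i j l; have := A l i j; have := A j l i.
have := T i j l; have := T j l i; have := T l i j.
by move: (N i j l) (N i l j) (N l i j) (N l j i) (N j l i) (N j i l) => *; lra.
Qed.

(** Passes from curvature components to the curvature vector R(F i, F j)(F l). Here [Gj] and [Gi]
    are the coefficients of the derivatives of [F l] along [F j] and [F i], [di] and [dj] are the
    derivatives of [Gj] along [F i] and of [Gi] along [F j], the [G2] families belong to the second
    differentiation, and [cn] to the bracket. *)
Lemma combine_coefs (R : realType) (v : 'I_3 -> 'rV[R]_3) (Gj Gi dj di cn : 'I_3 -> R)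
    (G2j G2i G2n : 'I_3 -> 'I_3 -> R) (k a b : R) (i j : 'I_3) :
  (forall m, di m - dj m +
     \sum_(n < 3) (Gj n * G2i n m - Gi n * G2j n m - cn n * G2n n m) =
     k * (a * (i == m)%:R - b * (j == m)%:R)) ->
  \sum_(n < 3) (Gj n *: (\sum_(r < 3) G2i n r *: v r) + di n *: v n) -
  \sum_(n < 3) (Gi n *: (\sum_(r < 3) G2j n r *: v r) + dj n *: v n) -
  \sum_(n < 3) cn n *: (\sum_(r < 3) G2n n r *: v r) = k *: (a *: v i - b *: v j).
Proof.
move=> coef.
have vE x : v x = \sum_(m < 3) (x == m)%:R *: v m.
  by rewrite sum3; elim/ord3_ind: x; rewrite !(scale0r, scale1r, addr0, add0r).
transitivity (\sum_(m < 3) (k * (a * (i == m)%:R - b * (j == m)%:R)) *: v m).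
  rewrite !sum3 -!coef !sum3; apply/rowP => t; rewrite !mxE; ring.
rewrite (vE i) (vE j) !sum3; apply/rowP => t; rewrite !mxE; ring.
Qed.

(** Trilinear extension of the constant-curvature formula from the frame [v] to vectors with
    coordinates [x], [y], [z]; both inner products are diagonal because the frame is orthogonal. *)
Lemma combine_constant (R : realType) (v : 'I_3 -> 'rV[R]_3) (x y z h : 'I_3 -> R) (k gYZ gXZ : R) :
  gYZ = \sum_(j < 3) y j * z j * h j -> gXZ = \sum_(j < 3) x j * z j * h j ->
  \sum_(i < 3) x i *: (\sum_(j < 3) y j *: (\sum_(l < 3) z l *:
    (k *: (((j == l)%:R * h j) *: v i - ((i == l)%:R * h i) *: v j)))) =
  k *: (gYZ *: (\sum_(i < 3) x i *: v i) - gXZ *: (\sum_(i < 3) y i *: v i)).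
Proof.
by move=> -> ->; rewrite !sum3 /=; apply/rowP => t; rewrite !mxE; ring.
Qed.

(* Sealed, like [lderiv], so that distinct structural functions are never
   compared by unfolding. *)
HB.lock Definition frame_coef (R : realType) (M : manifold3 R)
  (F : 'I_3 -> M -> 'rV[R]_3) : 'I_3 -> 'I_3 -> 'I_3 -> M -> R := structural_fun F.

Lemma structural_funE (R : realType) (M : manifold3 R) (F : 'I_3 -> M -> 'rV[R]_3) :
  structural_fun F = frame_coef F.
Proof. by rewrite frame_coef.unlock. Qed.

(** * Connection and curvature in an adapted frame *)

Section FrameGeometry.
Variables (R : realType) (M : manifold3 R) (S : contact_structure M).
Variables (kappa : R) (G : M -> 'M[R]_3).
Variable nabla : (M -> 'rV[R]_3) -> (M -> 'rV[R]_3) -> M -> 'rV[R]_3.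
Hypothesis h0 : h_vanishes S.
Hypothesis hkappa : is_invariant_kappa S (fun=> kappa).
Hypothesis kappa_neq0 : kappa != 0.
Hypothesis hG : is_extended_metric S kappa G.
Hypothesis hnabla : levi_civita G nabla.
Variables (U : set M) (F : 'I_3 -> M -> 'rV[R]_3).
Hypothesis aF : adapted_frame S U F.

Local Notation E := 'rV[R]_3.
Implicit Types (X Y Z : M -> E) (p q : M).
Local Notation eps := (frame_sign S).
Local Notation h := (frame_norm eps kappa).
Local Notation c := (frame_coef F).
Local Notation Gamma i j l :=
  (fun q => koszul_coef h (fun x y z => c x y z q) i j l).

Let oU : open U. Proof. by case: aF. Qed.
Let SF1 : section_on (cs_D S) U (F 1). Proof. by case: aF => _ []. Qed.
Let SF2 : section_on (cs_D S) U (F 2). Proof. by case: aF => _ []. Qed.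

Lemma smooth_frame i : smooth_vfield U (F i).
Proof.
elim/ord3_ind: i; [by case: aF|exact: SF1.1|exact: SF2.1].
Qed.

Lemma metric_sym q : (G q)^T = G q.
Proof. by have [[GS _] _ _] := hG; have [] := GS q. Qed.

Lemma smooth_metric V X Y : open V -> smooth_vfield V X -> smooth_vfield V Y ->
  smooth_fun V ((fun q => mform (G q) (X q) (Y q)) : M -> R^o).
Proof. by have [[_ GC] _ _] := hG; exact: GC. Qed.

Lemma frame_norm_neq0 i : h i != 0.
Proof.
by elim/ord3_ind: i; rewrite /frame_norm /= ?oner_neq0// frame_sign_neq0.
Qed.

Lemma metric_frame i j q : U q -> mform (G q) (F i q) (F j q) = (i == j)%:R * h i.
Proof.
move=> Uq; have [_ GD GX] := hG; have [g00 g01 g02] := GX _ _ aF _ Uq.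
have [_ _ _ /(_ q Uq)[g12 g22 g11] _] := aF.
have D1 := SF1.2 _ Uq; have D2 := SF2.2 _ Uq.
rewrite -!GD// in g12 g22 g11.
elim/ord3_ind: i; elim/ord3_ind: j; rewrite /frame_norm /= ?mul0r ?mul1r //;
  by rewrite mform_sym ?metric_sym.
Qed.

Lemma metric_combination (a : E) j q : U q ->
  mform (G q) (a *m frame_mx F q) (F j q) = a 0 j * h j.
Proof.
move=> Uq; rewrite mul_frame_mx !mformDl !mformZl !metric_frame//.
by elim/ord3_ind: j => /=; ring.
Qed.

Lemma frame_unit q : U q -> frame_mx F q \in unitmx.
Proof.
move=> Uq; apply: unitmx_ker => v vF; apply/rowP => j; rewrite mxE.
have := metric_combination v j Uq; rewrite vF mform0l => /esym/eqP.
by rewrite mulf_eq0 (negbTE (frame_norm_neq0 j)) orbF => /eqP.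
Qed.

Lemma frame_coord (v : E) j q : U q ->
  (v *m invmx (frame_mx F q)) 0 j = mform (G q) v (F j q) / h j.
Proof.
move=> Uq; rewrite -{2}(mulmxKV (frame_unit Uq) v) metric_combination//.
by rewrite mulfK// frame_norm_neq0.
Qed.

Lemma frame_expand (v : E) q : U q ->
  v = \sum_(i < 3) (mform (G q) v (F i q) / h i) *: F i q.
Proof.
move=> Uq; rewrite -{1}(mulmxKV (frame_unit Uq) v) mul_frame_mx sum3.
by rewrite !frame_coord.
Qed.

Lemma structuralE i j l q : U q ->
  c i j l q = mform (G q) (lbracket (F i) (F j) q) (F l q) / h l.
Proof. by move=> Uq; rewrite -structural_funE /structural_fun bracketE frame_coord. Qed.

Lemma smooth_structural i j l : smooth_fun U (c i j l : M -> R^o).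
Proof.
have Ci := smooth_lbracket oU (smooth_frame i) (smooth_frame j).
have Cm := smooth_metric oU Ci (smooth_frame l).
have Ch : smooth_fun U ((fun=> (h l)^-1) : M -> R^o) by exact: smooth_fun_cst.
apply: (smooth_fun_eq oU _ (smooth_funM oU Cm Ch)) => q Uq.
by rewrite structuralE.
Qed.

Lemma bracket_frame i j q : U q ->
  lbracket (F i) (F j) q = \sum_(l < 3) c i j l q *: F l q.
Proof.
move=> Uq; rewrite {1}(frame_expand (lbracket (F i) (F j) q) Uq).
by apply: eq_bigr => l _; rewrite structuralE.
Qed.

(** Otherwise [F 0 q] would lie in the distribution together with [F 1 q] and [F 2 q], and the plane
    would be the whole space. *)
Lemma distribution_coord0 (v : E) q : U q -> v \in cs_D S q -> mform (G q) v (F 0 q) = 0.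
Proof.
move=> Uq vD; have D1 := SF1.2 _ Uq; have D2 := SF2.2 _ Uq.
have [dim2 _] := cs_distribution S.
apply/eqP; apply: contraT => v0.
suff /dimvS : (fullv <= cs_D S q)%VS by rewrite dim2 dimvf.
have F0D : F 0 q \in cs_D S q.
  have := frame_expand v Uq; rewrite sum3 => vE.
  have a0 : mform (G q) v (F 0 q) / h 0 != 0.
    by rewrite mulf_neq0// invr_neq0// frame_norm_neq0.
  rewrite -[F 0 q](scalerK a0) memvZ//.
  move/eqP: vE; rewrite -addrA -subr_eq => /eqP <-.
  by rewrite memvB// memvD// memvZ.
apply/subvP => u _; rewrite (frame_expand u Uq) sum3.
by rewrite !memvD// memvZ.
Qed.

Lemma structural_anti i j l q : c j i l q = - c i j l q.
Proof. by rewrite -structural_funE /structural_fun !bracketE lbracketC mulNmx mxE. Qed.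

Lemma structural_values q : U q -> [/\ c 0 1 0 q = 0, c 0 2 0 q = 0 & c 1 2 0 q = 1].
Proof.
move=> Uq; have [_ _ _ _ /(_ q Uq)[b01 b02 b12]] := aF.
rewrite bracketE in b01; rewrite bracketE in b02; rewrite bracketE in b12.
rewrite (structuralE 0 1 0 Uq) (structuralE 0 2 0 Uq) (structuralE 1 2 0 Uq).
rewrite (distribution_coord0 Uq b01) (distribution_coord0 Uq b02) !mul0r.
split; [by []|by []|].
have := distribution_coord0 Uq b12; rewrite -scaleN1r addrC mform_linl metric_frame//.
rewrite mulN1r addrC => /subr0_eq ->.
by rewrite mul1r divff// frame_norm_neq0.
Qed.

(** On the pairs of frame fields [g] is constant, so its derivative drops out of [h], and [h = 0]
    says that the bracket with X0 acts on the distribution as a skew map. *)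
Lemma structural_h q : U q ->
  [/\ c 0 1 1 q = 0, c 0 2 2 q = 0 & c 0 2 1 q = - eps * c 0 1 2 q].
Proof.
move=> Uq; have [_ GD _] := hG.
have [_ _ _ ortho /(_ q Uq)[b01 b02 b12]] := aF.
rewrite !bracketE in b01 b02; have D1 := SF1.2 _ Uq; have D2 := SF2.2 _ Uq.
have hh Y Z (k : R) : section_on (cs_D S) U Y -> section_on (cs_D S) U Z ->
    (forall r, U r -> cs_g S r (Y r) (Z r) = k) ->
    lbracket (F 0) Y q \in cs_D S q -> lbracket (F 0) Z q \in cs_D S q ->
    mform (G q) (lbracket (F 0) Y q) (Z q) + mform (G q) (Y q) (lbracket (F 0) Z q) = 0.
  move=> SY SZ kE YD ZD; have := h0 aF SY SZ Uq; rewrite /invariant_h vderivE !bracketE.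
  have -> : lderiv (F 0) ((fun r => cs_g S r (Y r) (Z r)) : M -> R^o) q = 0.
    by rewrite -(lderiv_cst (F 0) (k : R^o) q); exact: (lderiv_eq oU Uq).
  have DY := SY.2 _ Uq; have DZ := SZ.2 _ Uq.
  rewrite -(GD q _ _ YD DZ) -(GD q _ _ DY ZD).
  by move: (mform _ _ _) (mform _ _ _) => a b; lra.
have g11 r : U r -> cs_g S r (F 1 r) (F 1 r) = eps by case/ortho.
have g22 r : U r -> cs_g S r (F 2 r) (F 2 r) = 1 by case/ortho.
have g12 r : U r -> cs_g S r (F 1 r) (F 2 r) = 0 by case/ortho.
have e11 := hh _ _ _ SF1 SF1 g11 b01 b01.
have e22 := hh _ _ _ SF2 SF2 g22 b02 b02.
have e12 := hh _ _ _ SF1 SF2 g12 b01 b02.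
rewrite [X in _ + X]mform_sym ?metric_sym// in e11.
rewrite [X in _ + X]mform_sym ?metric_sym// in e22.
rewrite [X in _ + X]mform_sym ?metric_sym// in e12.
rewrite (structuralE 0 1 1 Uq) (structuralE 0 2 2 Uq) (structuralE 0 2 1 Uq).
rewrite (structuralE 0 1 2 Uq).
have z12 : mform (G q) (lbracket (F 0) (F 2) q) (F 1 q) =
   - mform (G q) (lbracket (F 0) (F 1) q) (F 2 q).
  by apply/eqP; rewrite -addr_eq0 addrC; apply/eqP.
rewrite (double_eq0 e11) (double_eq0 e22) z12 !mul0r; split; [by []|by []|].
rewrite /frame_norm /=.
by have [->|->] := frame_signP S; field.
Qed.

(** Since [c 0 2 1] is [- eps] times [c 0 1 2], the half-difference in one signature and the
    half-sum in the other both collapse to [c 0 1 2]. *)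
Lemma kappa_frame q : U q -> kappa =
  lderiv (F 1) (c 1 2 2 : M -> R^o) q - eps * lderiv (F 2) (c 1 2 1 : M -> R^o) q
  - eps * c 1 2 1 q ^+ 2 - c 1 2 2 q ^+ 2 + c 0 1 2 q.
Proof.
move=> Uq; have [_ _ c021] := structural_h Uq; have kE := hkappa aF Uq.
rewrite /frame_sign in c021 *; rewrite /kappa_formula structural_funE in kE; move: c021 kE.
case: cs_kind => c021; rewrite !vderivE => kE.
  have riem (a b x y w z : R) : z = - 1 * w ->
      a - b - x ^+ 2 - y ^+ 2 + 2^-1 * (w - z) = a - 1 * b - 1 * x ^+ 2 - y ^+ 2 + w.
    by move=> ->; field.
  exact: etrans kE (riem _ _ _ _ _ _ c021).
have lor (a b x y w z : R) : z = - -1 * w ->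
    a + b + x ^+ 2 - y ^+ 2 + 2^-1 * (w + z) = a - -1 * b - -1 * x ^+ 2 - y ^+ 2 + w.
  by move=> ->; field.
exact: etrans kE (lor _ _ _ _ _ _ c021).
Qed.

Lemma nabla_frame i j q : U q ->
  nabla (F i) (F j) q = \sum_(l < 3) Gamma i j l q *: F l q.
Proof.
move=> Uq; have [nC nT nG] := hnabla.
have CF := smooth_frame.
rewrite {1}(frame_expand (nabla (F i) (F j) q) Uq); apply: eq_bigr => l _; congr (_ *: _).
pose N i j l := mform (G q) (nabla (F i) (F j) q) (F l q).
pose B i j l := mform (G q) (lbracket (F i) (F j) q) (F l q).
have NA x y z : N x y z + N x z y = 0.
  have := nG U (F x) (F y) (F z) oU (CF x) (CF y) (CF z) q Uq.
  rewrite /cov_metric vderivE.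
  have -> : lderiv (F x) ((fun q => mform (G q) (F y q) (F z q)) : M -> R^o) q = 0.
    rewrite -(lderiv_cst (F x) ((y == z)%:R * h y : R^o) q).
    by apply: (lderiv_eq oU Uq) => // r Ur; exact: metric_frame.
  rewrite [mform (G q) (F y q) _](mform_sym _ _ (metric_sym q)) -/(N x y z) -/(N x z y).
  by rewrite sub0r -opprD => /eqP; rewrite oppr_eq0 => /eqP.
have NT x y z : N x y z - N y x z = B x y z.
  have := nT U (F x) (F y) oU (CF x) (CF y) q Uq; rewrite bracketE /B => <-.
  by rewrite -(scaleN1r (nabla (F y) (F x) q)) mformDl mformZl mulN1r.
have cB x y z : B x y z = c x y z q * h z.
  by rewrite structuralE// divfK// frame_norm_neq0.
have := koszul_formula i j l NA NT; rewrite !cB -/(N i j l) /koszul_coef => <-.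
by field; exact: frame_norm_neq0.
Qed.

Lemma smooth_Gamma i j l : smooth_fun U (Gamma i j l : M -> R^o).
Proof.
have Ck (k : R) : smooth_fun U ((fun=> k) : M -> R^o) by exact: smooth_fun_cst.
have CM x y z (k : R) : smooth_fun U ((fun q => c x y z q * k) : M -> R^o).
  exact: (smooth_funM oU (smooth_structural x y z) (Ck k)).
have := smooth_funD oU (smooth_funB oU (CM i j l (h l)) (CM j l i (h i))) (CM l i j (h j)).
by move=> /(smooth_funM oU) => /(_ _ (Ck (2 * h l)^-1)).
Qed.

(** [koszul_coef] is linear in the structural functions with constant coefficients, hence commutes
    with derivations. *)
Lemma lderiv_Gamma X i j l q : U q -> lderiv X (Gamma i j l : M -> R^o) q =
  koszul_coef h (fun x y z => lderiv X (c x y z : M -> R^o) q) i j l.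
Proof.
move=> Uq; have CM x y z (k : R) : smooth_fun U ((fun q => c x y z q * k) : M -> R^o).
  apply: (smooth_funM oU (smooth_structural x y z)); exact: smooth_fun_cst.
have CB := smooth_funB oU (CM i j l (h l)) (CM j l i (h i)).
rewrite /koszul_coef (lderivMr X _ Uq (smooth_funD oU CB (CM l i j (h j)))).
rewrite (lderivD X Uq CB (CM l i j (h j))) (lderivB X oU Uq (CM i j l (h l)) (CM j l i (h i))).
by rewrite !(lderivMr X _ Uq (smooth_structural _ _ _)).
Qed.

Lemma jacobi_frame q m : U q ->
  let d n x y z := lderiv (F n) (c x y z : M -> R^o) q in
  d 0 1 2 m + d 1 2 0 m + d 2 0 1 m +
    \sum_(l < 3) (c 1 2 l q * c 0 l m q + c 2 0 l q * c 1 l m q + c 0 1 l q * c 2 l m q) = 0.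
Proof.
move=> Uq d; have CF := smooth_frame.
have := jacobi oU Uq (CF 0) (CF 1) (CF 2).
have bb i j l : lbracket (F i) (lbracket (F j) (F l)) q = \sum_(n < 3)
    (c j l n q *: (\sum_(r < 3) c i n r q *: F r q) + d i j l n *: F n q).
  have -> : lbracket (F i) (lbracket (F j) (F l)) q =
      lbracket (F i) (fun r => \sum_(n < 3) c j l n r *: F n r) q.
    by apply: (lbracket_eq oU Uq) => // r Ur; exact: bracket_frame.
  rewrite (lbracket_sumr oU Uq (smooth_structural j l) (CF i) CF).
  by apply: eq_bigr => n _; rewrite bracket_frame.
rewrite !bb.
(* [w] is the row of frame components of the cyclic sum of double brackets; the frame is
   independent, so each component vanishes. *)
pose w : E := \row_m (d 0 1 2 m + d 1 2 0 m + d 2 0 1 m +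
    \sum_(l < 3) (c 1 2 l q * c 0 l m q + c 2 0 l q * c 1 l m q + c 0 1 l q * c 2 l m q)).
move=> J.
have wF : w *m frame_mx F q = 0.
  have wE r : w 0 r = d 0 1 2 r + d 1 2 0 r + d 2 0 1 r +
      \sum_(l < 3) (c 1 2 l q * c 0 l r q + c 2 0 l q * c 1 l r q + c 0 1 l q * c 2 l r q).
    by rewrite mxE.
  apply: (etrans _ J); rewrite mul_frame_mx !wE !sum3; clear.
  apply/rowP => t; rewrite !mxE.
  ring.
have := metric_combination w m Uq; rewrite wF mform0l => /esym/eqP.
by rewrite mulf_eq0 (negbTE (frame_norm_neq0 m)) orbF mxE => /eqP.
Qed.

Lemma curvature_frame i j l q : U q -> curvature nabla (F i) (F j) (F l) q =
  (eps * kappa / 4) *: (((j == l)%:R * h j) *: F i q - ((i == l)%:R * h i) *: F j q).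
Proof.
move=> Uq; have [nC nT nG] := hnabla; have CF := smooth_frame.
have nn x y z : nabla (F x) (nabla (F y) (F z)) q = \sum_(n < 3)
    (Gamma y z n q *: (\sum_(r < 3) Gamma x n r q *: F r q) +
     koszul_coef h (fun a b e => lderiv (F x) (c a b e : M -> R^o) q) y z n *: F n q).
  have -> : nabla (F x) (nabla (F y) (F z)) q =
      nabla (F x) (fun r => \sum_(n < 3) Gamma y z n r *: F n r) q.
    apply: (nabla_eq nC oU Uq (CF x) (smooth_nabla nC oU (CF y) (CF z))) => // r Ur.
    exact: nabla_frame.
  rewrite (nabla_sumr nC oU Uq (smooth_Gamma y z) (CF x) CF).
  by apply: eq_bigr => n _; rewrite nabla_frame// lderiv_Gamma.
have nb : nabla (lbracket (F i) (F j)) (F l) q = \sum_(n < 3)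
    (c i j n q *: (\sum_(r < 3) Gamma n l r q *: F r q)).
  have -> : nabla (lbracket (F i) (F j)) (F l) q =
      nabla (fun r => \sum_(n < 3) c i j n r *: F n r) (F l) q.
    apply: (nabla_eq nC oU Uq (smooth_lbracket oU (CF i) (CF j)) (CF l)) => // r Ur.
    exact: bracket_frame.
  rewrite (nabla_suml nC oU Uq (smooth_structural i j) CF (CF l)).
  by apply: eq_bigr => n _; rewrite nabla_frame.
have [c010 c020 c120] := structural_values Uq.
have [c011 c022 c021] := structural_h Uq.
(* Differentiating a relation between structural functions requires it on all of [U], not only at
   [q]; the pointwise facts are therefore passed below as functions of the point. *)
have dcst X x y z (k : R) : (forall r, U r -> c x y z r = k) ->
    lderiv X (c x y z : M -> R^o) q = 0.
  by move=> ck; rewrite -(lderiv_cst X (k : R^o) q); exact: (lderiv_eq oU Uq).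
have := @frame_curvature_coef R eps kappa (fun x y z => c x y z q)
  (fun n x y z => lderiv (F n) (c x y z : M -> R^o) q)
  (frame_signP S) kappa_neq0 (fun x y z => structural_anti x y z q).
have dA n x y z : lderiv (F n) (c y x z : M -> R^o) q = - lderiv (F n) (c x y z : M -> R^o) q.
  rewrite -(lderivN (F n) Uq (smooth_structural x y z)).
  by apply: (lderiv_eq oU Uq) => // r Ur; exact: structural_anti.
have d021 n : lderiv (F n) (c 0 2 1 : M -> R^o) q = - eps * lderiv (F n) (c 0 1 2 : M -> R^o) q.
  rewrite mulrC -(lderivMr (F n) (- eps) Uq (smooth_structural 0 1 2)).
  apply: (lderiv_eq oU Uq) => // r Ur; have [_ _ ->] := structural_h Ur.
  by rewrite mulrC.
move=> /(_ dA c010 c011 c020 c022 c021 c120).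
move=> /(_ (fun n => dcst (F n) _ _ _ _
  (fun r Ur => let: And3 e _ _ := structural_values Ur in e))).
move=> /(_ (fun n => dcst (F n) _ _ _ _
  (fun r Ur => let: And3 e _ _ := structural_h Ur in e))).
move=> /(_ (fun n => dcst (F n) _ _ _ _
  (fun r Ur => let: And3 _ e _ := structural_values Ur in e))).
move=> /(_ (fun n => dcst (F n) _ _ _ _
  (fun r Ur => let: And3 _ e _ := structural_h Ur in e))).
move=> /(_ d021).
move=> /(_ (fun n => dcst (F n) _ _ _ _
  (fun r Ur => let: And3 _ _ e := structural_values Ur in e))).
move=> /(_ (kappa_frame Uq) (fun m => jacobi_frame m Uq)) /=.
move=> coef.
rewrite /curvature bracketE !nn nb; exact: combine_coefs (coef i j l).
Qed.

Lemma frame_coefs_smooth V X i : open V -> V `<=` U -> smooth_vfield V X ->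
  smooth_fun V ((fun q => mform (G q) (X q) (F i q) / h i) : M -> R^o).
Proof.
move=> oV VU CX; have Cm := smooth_metric oV CX (smooth_vfield_sub VU (smooth_frame i)).
have Ch : smooth_fun V ((fun=> (h i)^-1) : M -> R^o) by exact: smooth_fun_cst.
exact: (smooth_funM oV Cm Ch).
Qed.

(** The set [V] may be smaller than [U], because the coordinate fields that define the Ricci tensor
    are available only on the source of a chart. *)
Lemma curvature_constant V X Y Z p : open V -> V `<=` U -> V p ->
  smooth_vfield V X -> smooth_vfield V Y -> smooth_vfield V Z ->
  curvature nabla X Y Z p = (eps * kappa / 4) *:
    (mform (G p) (Y p) (Z p) *: X p - mform (G p) (X p) (Z p) *: Y p).
Proof.
move=> oV VU Vp CX CY CZ; have [nC nT nG] := hnabla; have Up := VU _ Vp.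
have CF i : smooth_vfield V (F i) by exact: (smooth_vfield_sub VU (smooth_frame i)).
pose coord X i : M -> R^o := fun q => mform (G q) (X q) (F i q) / h i.
have Cc T i : smooth_vfield V T -> smooth_fun V (coord T i).
  exact: frame_coefs_smooth oV VU.
have XE T q : V q -> T q = \sum_(i < 3) coord T i q *: F i q.
  by move=> /VU Uq; exact: frame_expand.
have eX : curvature nabla X Y Z p =
    \sum_(i < 3) coord X i p *: curvature nabla (F i) Y Z p.
  rewrite -(tensor_sum (T := fun X => curvature nabla X Y Z p) oV _ (fun i => Cc _ i CX) CF).
    by apply: (curvature_eq nC oV Vp CX CY CZ) => // q Vq; exact: XE.
  by move=> b X1 X2 Cb C1 C2; exact: (curvature_linl nC oV Vp Cb C1 C2 CY CZ).
have eY i : curvature nabla (F i) Y Z p =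
    \sum_(j < 3) coord Y j p *: curvature nabla (F i) (F j) Z p.
  rewrite -(tensor_sum (T := fun Y => curvature nabla (F i) Y Z p) oV _ (fun j => Cc _ j CY) CF).
    by apply: (curvature_eq nC oV Vp (CF i) CY CZ) => // q Vq; exact: XE.
  (* Linearity in the second argument is obtained from the first by antisymmetry. *)
  move=> b Y1 Y2 Cb C1 C2; have CbY := smooth_vfield_lin oV Cb C1 C2.
  rewrite (curvature_anti nC oV Vp (CF i) CbY CZ) (curvature_anti nC oV Vp (CF i) C1 CZ).
  rewrite (curvature_anti nC oV Vp (CF i) C2 CZ).
  by rewrite (curvature_linl nC oV Vp Cb C1 C2 (CF i) CZ) opprD scalerN.
have eZ i j : curvature nabla (F i) (F j) Z p =
    \sum_(l < 3) coord Z l p *: curvature nabla (F i) (F j) (F l) p.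
  rewrite -(tensor_sum (T := fun Z => curvature nabla (F i) (F j) Z p) oV _ (fun l => Cc _ l CZ) CF).
    by apply: (curvature_eq nC oV Vp (CF i) (CF j) CZ) => // q Vq; exact: XE.
  by move=> b Z1 Z2 Cb C1 C2; exact: (curvature_linr nC oV Vp Cb (CF i) (CF j) C1 C2).
rewrite eX; under eq_bigr => i _.
  rewrite eY; under eq_bigr => j _.
    rewrite eZ; under eq_bigr => l _ do rewrite curvature_frame//.
    over.
  over.
have FZ j : mform (G p) (F j p) (Z p) = coord Z j p * h j.
  by rewrite (mform_sym _ _ (metric_sym p)) divfK// frame_norm_neq0.
have gZ T : mform (G p) (T p) (Z p) =
    \sum_(j < 3) mform (G p) (T p) (F j p) / h j * coord Z j p * h j.
  rewrite {1}(frame_expand (T p) Up) sum3 !mformDl !mformZl sum3.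
  by rewrite !FZ !mulrA.
have eXY := combine_constant (fun i => F i p) (eps * kappa / 4) (gZ Y) (gZ X).
by apply: (etrans eXY); rewrite -(XE X p Vp) -(XE Y p Vp).
Qed.

End FrameGeometry.

(** * The Einstein-Weyl equation and the signature *)

Section EinsteinWeyl.
Variables (R : realType) (M : manifold3 R) (S : contact_structure M).
Variables (kappa : R) (G : M -> 'M[R]_3).
Variable nabla : (M -> 'rV[R]_3) -> (M -> 'rV[R]_3) -> M -> 'rV[R]_3.
Hypothesis h0 : h_vanishes S.
Hypothesis hkappa : is_invariant_kappa S (fun=> kappa).
Hypothesis kappa_neq0 : kappa != 0.
Hypothesis hG : is_extended_metric S kappa G.
Hypothesis hnabla : levi_civita G nabla.

Local Notation E := 'rV[R]_3.
Implicit Types (U V : set M) (X Y Z : M -> E) (p q : M).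
Local Notation eps := (frame_sign S).

(** Tracing G(Y, Z) X - G(X, Z) Y over X gives (3 - 1) G(Y, Z), which turns the factor 1/4 into
    1/2. *)
Lemma ricci_constant p : ricci nabla p = (eps * kappa / 2) *: G p.
Proof.
have [U [F [aF Up]]] := adapted_frame_exists S p.
have oU : open U by case: aF.
pose V := U `&` chart_src (chart_at p).
have oV : open V by exact: open_setI_chart.
have Vp : V p by split=> //; exact: chart_at_src.
have VU : V `<=` U by move=> ? [].
have CZ i : smooth_vfield V (coord_vfield p i).
  by apply: smooth_vfield_sub (smooth_coord_vfield p i) => ? [].
apply/matrixP => i j; rewrite mxE [RHS]mxE.
under eq_bigr => k _.
  rewrite (curvature_constant h0 hkappa kappa_neq0 hG hnabla aF oV VU Vp (CZ k) (CZ i) (CZ j)).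
  rewrite !coord_vfield_at !mform_delta !mxE /=.
  over.
rewrite sum3 /=.
by elim/ord3_ind: i; elim/ord3_ind: j => /=; field.
Qed.

Lemma conformal_unit (f : R) p : 0 < f -> f *: G p \in unitmx.
Proof.
move=> f0; have [[GS _] _ _] := hG; have [_ Gu] := GS p.
by rewrite unitmxZ// unitfE gt_eqF.
Qed.

Lemma ricci_sym_constant p : ricci_sym nabla p = (eps * kappa / 2) *: G p.
Proof.
rewrite /ricci_sym ricci_constant linearZ /= (metric_sym hG) -scalerDl scalerA.
by congr (_ *: _); field.
Qed.

Lemma scalar_curvature_constant p (f : R) : 0 < f ->
  \tr (invmx (f *: G p) *m ricci nabla p) = 3 * (eps * kappa / 2) / f.
Proof.
move=> f0; have f0' : f != 0 by rewrite gt_eqF.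
have [[GS _] _ _] := hG; have [_ Gu] := GS p.
rewrite ricci_constant -scalemxAr invmxZ ?conformal_unit// -scalemxAl mulVmx// !mxtraceZ mxtrace1.
by rewrite mulrC [f^-1 * _]mulrC mulrAC.
Qed.

(** The Ricci tensor depends only on [nabla]. Passing to [f *: G] divides the scalar curvature by
    [f] and multiplies the metric by [f], so the right-hand side does not change. *)
Lemma conformal_einstein G' p : conformal_class G G' ->
  ricci_sym nabla p = (3^-1 * scalar_curvature nabla G' p) *: G' p.
Proof.
move=> [f [Cf f0 G'E]]; rewrite /scalar_curvature G'E scalar_curvature_constant//.
rewrite ricci_sym_constant scalerA; congr (_ *: _).
by field; rewrite gt_eqF.
Qed.

Lemma conformal_weyl G' : conformal_class G G' -> exists2 eta, smooth_form setT eta &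
  forall U X Y Z, open U -> smooth_vfield U X -> smooth_vfield U Y -> smooth_vfield U Z ->
  forall p, U p ->
    cov_metric nabla G' X Y Z p = form_eval eta X p * mform (G' p) (Y p) (Z p).
Proof.
move=> [f [Cf f0 G'E]].
pose eta p : 'cV[R]_3 := \col_i (tderiv (f : M -> R^o) p (delta_mx 0 i) / f p).
have etaE X p : form_eval eta X p = lderiv X (f : M -> R^o) p / f p.
  rewrite -vderivE (@vderiv_sum_basis _ _ _ setT)// /form_eval mxE mulr_suml.
  by apply: eq_bigr => i _; rewrite mxE mulrA.
exists eta.
  move=> V X oV _ CX.
  have CfV : smooth_fun V (f : M -> R^o) by exact: smooth_fun_sub Cf.
  have CfI : smooth_fun V ((fun p => (f p)^-1) : M -> R^o).
    by apply: (smooth_funV oV _ CfV) => p _; rewrite gt_eqF.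
  apply: (smooth_fun_eq oV _ (smooth_funM oV (smooth_lderiv oV CX CfV) CfI)) => p _.
  by rewrite etaE.
move=> U X Y Z oU CX CY CZ p Up; have [nC nT nG] := hnabla.
have CfU : smooth_fun U (f : M -> R^o) by exact: smooth_fun_sub Cf.
have := nG U X Y Z oU CX CY CZ p Up; rewrite /cov_metric !vderivE !G'E !mformZ.
have -> : lderiv X ((fun q => mform (G' q) (Y q) (Z q)) : M -> R^o) p =
    f p * lderiv X ((fun q => mform (G q) (Y q) (Z q)) : M -> R^o) p +
    lderiv X (f : M -> R^o) p * mform (G p) (Y p) (Z p).
  rewrite -(lderivM X Up CfU (smooth_metric hG oU CY CZ)).
  by apply: (lderiv_eq oU Up) => // q Uq; rewrite G'E mformZ.
rewrite etaE.
move: (lderiv X _ p) (lderiv X _ p) (mform _ _ _) (mform _ _ _) (mform _ _ _) => a b x y z e.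
by move/subr0_eq: e => /(canRL (subrK _)) ->; field; rewrite gt_eqF.
Qed.

(** The diagonal form of [G] in the frame: the signs of the norms decide the signature. *)
Lemma metric_square (F : 'I_3 -> M -> E) U (v : E) p : adapted_frame S U F -> U p ->
  mform (G p) v v = \sum_(i < 3) mform (G p) v (F i p) ^+ 2 / frame_norm eps kappa i.
Proof.
move=> aF Up; rewrite {1}(frame_expand kappa_neq0 hG aF v Up) sum3 !mformDl !mformZl sum3.
rewrite !(mform_sym (F _ p) v (metric_sym hG p)) !expr2.
by rewrite ![_ / _ * _]mulrAC.
Qed.

Lemma extended_riemannian : cs_kind S = SubRiemannian -> 0 < kappa ->
  riemannian_signature (conformal_class G).
Proof.
move=> kS k0 G' [f [_ f0 G'E]] p v v0; rewrite G'E mformZ mulr_gt0//.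
have [U [F [aF Up]]] := adapted_frame_exists S p.
rewrite (metric_square v aF Up).
have hpos i : 0 < frame_norm eps kappa i.
  by elim/ord3_ind: i; rewrite /frame_norm /frame_sign kS /=.
have term0 i : 0 <= mform (G p) v (F i p) ^+ 2 / frame_norm eps kappa i.
  by rewrite divr_ge0 ?sqr_ge0 ?(ltW (hpos i)).
rewrite lt_neqAle sumr_ge0 ?andbT// eq_sym psumr_eq0//.
apply: contra v0 => /allP v0; apply/eqP.
rewrite (frame_expand kappa_neq0 hG aF v Up) big1// => i _.
have := v0 i (mem_index_enum i); rewrite /= mulf_eq0 invr_eq0 (gt_eqF (hpos i)) orbF sqrf_eq0.
by move=> /eqP ->; rewrite mul0r scale0r.
Qed.

(** Two vectors of opposite sign suffice, as the signature is (-,+,+) up to an overall sign: a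
    sub-Lorentzian structure with negative [kappa] has two negative directions. *)
Lemma extended_lorentzian : ~ (cs_kind S = SubRiemannian /\ 0 < kappa) ->
  lorentzian_signature (conformal_class G).
Proof.
move=> nR G' [f [_ f0 G'E]] p; rewrite G'E; split; first exact: conformal_unit.
have [U [F [aF Up]]] := adapted_frame_exists S p.
have FF i : mform (f p *: G p) (F i p) (F i p) = f p * frame_norm eps kappa i.
  by rewrite mformZ (metric_frame hG aF i i Up) eqxx mul1r.
case kS : (cs_kind S).
  (* In the sub-Riemannian case [kappa] is negative here, so the Reeb field supplies the negative
     vector. *)
  exists (F 0 p), (F 2 p); rewrite !FF /frame_norm /= mulr1; split; last exact: f0.
  rewrite pmulr_rlt0// lt_neqAle kappa_neq0 leNgt /=.
  by apply/negP => k0; apply: nR.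
exists (F 1 p), (F 2 p); rewrite !FF /frame_norm /frame_sign kS /= mulr1 mulrN1.
by rewrite oppr_lt0.
Qed.

End EinsteinWeyl.

Theorem theorem3p2 (R : realType) (M : manifold3 R) (S : contact_structure M)
    (kappa : R) (G : M -> 'M[R]_3)
    (nabla : vfield M -> vfield M -> M -> 'rV[R]_3)
    (h0 : h_vanishes S)
    (hkappa : is_invariant_kappa S (fun=> kappa))
    (kappa_neq0 : kappa != 0)
    (hG : is_extended_metric S kappa G)
    (hnabla : levi_civita G nabla) :
  [/\ einstein_weyl (conformal_class G) nabla,
      (cs_kind S = SubRiemannian /\ 0 < kappa ->
        riemannian_signature (conformal_class G))
    & (~ (cs_kind S = SubRiemannian /\ 0 < kappa) ->
        lorentzian_signature (conformal_class G))].
Proof.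
have [nC nT nG] := hnabla; have [GM _ _] := hG.
split.
- split.
    split=> //; first by exists G.
    by move=> G' CG'; exact: (conformal_weyl hG hnabla CG').
  by move=> G' CG' p; exact: (conformal_einstein h0 hkappa kappa_neq0 hG hnabla p CG').
- by move=> [kS k0]; exact: (extended_riemannian kappa_neq0 hG kS k0).
- exact: (extended_lorentzian kappa_neq0 hG).
Qed.
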